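(* Let $t\ge2$ and let $\lambda_1,\dots,\lambda_t$ be distinct lines in $\mathbb P^2$, no three concurrent; let $C_t$ be the set of their $\binom{t}{2}$ pairwise intersection points and $\mathbb Z_t$ the first infinitesimal neighborhood of $C_t$. (a) The first difference of the Hilbert function of $\mathbb Z_t$ is $\Delta h_{\mathbb Z_t}(d)=d+1$ for $0\le d\le t-1$, $\Delta h_{\mathbb Z_t}(d)=t$ for $t\le d\le 2t-3$, and $\Delta h_{\mathbb Z_t}(d)=0$ for $d\ge 2t-2$. (b) If $\mathbb X\subset\mathbb P^2$ is any reduced finite set of points whose Hilbert function has first difference $(1,2,3,\dots,t-1)$ (in degrees $0,\dots,t-2$, zero afterwards) and $\mathbb Z$ is its first infinitesimal neighborhood, then $h_{\mathbb Z}(d)\ge h_{\mathbb Z_t}(d)$ for all $d$. (c) With $\mathbb X,\mathbb Z$ as in (b), if $h_{\mathbb Z}(t)=h_{\mathbb Z_t}(t)$ (in particular if $h_{\mathbb Z}=h_{\mathbb Z_t}$), then $\mathbb X$ is the set of pairwise intersection points of some $t$ distinct lines, no three concurrent, so that $\mathbb Z$ is a scheme $\mathbb Z_t$ for a different choice of lines.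
   Context: $k$ is an infinite field of characteristic zero, $R=k[x_0,x_1,x_2]$. For a zero-dimensional scheme with saturated ideal $I$, $h(d)=\dim_k(R/I)_d$ and $\Delta h(d)=h(d)-h(d-1)$. The first infinitesimal neighborhood of $\{P_1,\dots,P_s\}$ (prime ideals $\wp_i$) is the scheme defined by $\wp_1^2\cap\cdots\cap\wp_s^2$. *)

(* Defs.v *)
From HB Require Import structures.
From mathcomp Require Import all_boot all_order all_algebra.
From mathcomp Require Import mpoly.
From Stdlib Require Import ClassicalEpsilon.

Set Implicit Arguments.
Unset Strict Implicit.
Unset Printing Implicit Defensive.

Import Order.TTheory GRing.Theory.
Local Open Scope ring_scope.

Section Defs.
Variable k : fieldType.

Notation R := {mpoly k[3]}.

(* A vector of homogeneous coordinates; a point of P^2 is a nonzero one. *)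
Definition vec3 := {ffun 'I_3 -> k}.

Definition nonzero3 (p : vec3) : Prop := exists i, p i != 0.

Definition proportional (p q : vec3) : Prop := exists c : k, c != 0 /\ forall i, q i = c * p i.

(* Prime (homogeneous) ideal of the point [p]: polynomials all of whose
   homogeneous components vanish at p. *)
Definition pt_ideal (p : vec3) : R -> Prop :=
  fun f => forall d : nat, (pihomog mdeg d f).@[p] = 0.

Definition ideal_sq (J : R -> Prop) : R -> Prop :=
  fun f => exists s : seq (R * R),
    (forall x, x \in s -> J x.1 /\ J x.2) /\ f = \sum_(x <- s) x.1 * x.2.

Definition red_ideal (S : vec3 -> Prop) : R -> Prop :=
  fun f => forall p, nonzero3 p -> S p -> pt_ideal p f.

(* Ideal of the first infinitesimal neighborhood of S: intersection of the
   squares of the prime ideals. *)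
Definition fat_ideal (S : vec3 -> Prop) : R -> Prop :=
  fun f => forall p, nonzero3 p -> S p -> ideal_sq (pt_ideal p) f.

(* (R/I)_d has dimension n: there are n forms of degree d forming a basis of
   R_d modulo I_d. *)
Definition hilb_is (I : R -> Prop) (d n : nat) : Prop :=
  exists s : n.-tuple R,
    [/\ forall i, tnth s i \is d.-homog,
        (forall c : 'I_n -> k, I (\sum_(i < n) c i *: tnth s i) -> forall i, c i = 0) &
        (forall f, f \is d.-homog -> exists c : 'I_n -> k,
              I (f - \sum_(i < n) c i *: tnth s i))].

Definition hilb (I : R -> Prop) (d : nat) : nat :=
  epsilon (inhabits 0%N) (fun n => hilb_is I d n).

Definition dhilb (I : R -> Prop) (d : nat) : int :=
  match d with
  | 0%N => (hilb I 0)%:Z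
  | d'.+1 => (hilb I d)%:Z - (hilb I d')%:Z
  end.

Definition on_line (l p : vec3) : Prop := \sum_(i < 3) l i * p i = 0.

Definition good_lines (t : nat) (L : 'I_t -> vec3) : Prop :=
  (forall i, nonzero3 (L i)) /\
  (forall i j, i != j -> ~ proportional (L i) (L j)) /\
  (forall i j m p, i != j -> j != m -> i != m -> nonzero3 p ->
     ~ [/\ on_line (L i) p, on_line (L j) p & on_line (L m) p]).

Definition inter_pts (t : nat) (L : 'I_t -> vec3) : vec3 -> Prop :=
  fun p => exists i j : 'I_t, i != j /\ on_line (L i) p /\ on_line (L j) p.

Definition point_list (X : seq vec3) : Prop :=
  (forall p, p \in X -> nonzero3 p) /\
  (forall i j, (i < size X)%N -> (j < size X)%N -> i != j ->
     ~ proportional (nth [ffun=> 0] X i) (nth [ffun=> 0] X j)).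

Definition in_list (X : seq vec3) : vec3 -> Prop := fun p => p \in X.

Definition same_points (X : seq vec3) (S : vec3 -> Prop) : Prop :=
  (forall p, p \in X -> S p) /\
  (forall p, nonzero3 p -> S p -> exists2 q, q \in X & proportional q p).

End Defs.

(* Main.v *)
Require Import Defs.
From HB Require Import structures.
From mathcomp Require Import all_boot all_order all_algebra.
From mathcomp Require Import mpoly ring zify.
From Stdlib Require Import Classical ClassicalEpsilon.
Import GRing.Theory.
Local Open Scope ring_scope.

Set Implicit Arguments.
Unset Strict Implicit.
Unset Printing Implicit Defensive.

(** Write t = e + 2, and let X be a set of binom(t, 2) points on no curve of
    degree e.  Each point P of X has an interpolant g of degree e (1 at P, 0 at
    the other points), and the forms g^2 l with l linear show that the double
    points of X impose independent conditions in degree 2t-3.  No form of degree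
    below t is singular along X, because its derivatives would vanish on X.
    Restriction to a general line shows that the dimensions of the systems of
    forms singular along X grow in a strictly convex way from 0 in degree t-1 to
    binom(t-1, 2) in degree 2t-3, which bounds them from above.  For a star
    configuration these systems consist of the multiples of the product of the
    lines, by Bezout on each line, and the bound is attained.

    In the equality case there is a form F of degree t singular along X, and the
    forms of degree 2t-3 singular along X are the multiples of F.  They include
    l g_i g_j, where l is the line through the points P_i and P_j; this forces F
    to have a linear factor through every P_i.  The product of the linear factors
    of F vanishes on X, so it has degree at least t-1, and F is a product of t
    lines.  The product of any t-2 of them is nonzero at some point of X, which
    is then the intersection of the other two lines and on no third one. *)

(** * Forms in several variables *)

Section Forms.
Variables (n : nat) (k : fieldType).
Implicit Types (f g h : {mpoly k[n]}) (v : 'I_n -> k).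

(** Lets identities between ring morphisms, such as restriction, substitution and evaluation, be
    checked on constants and variables only. *)
Lemma mpoly_ring_ind (P : {mpoly k[n]} -> Prop) :
  (forall c, P c%:MP) -> (forall i, P 'X_i) ->
  (forall f g, P f -> P g -> P (f + g)) ->
  (forall f g, P f -> P g -> P (f * g)) -> forall f, P f.
Proof.
move=> PC PX PD PM; elim/mpolyind => [|c m p _ _ Pp]; first by rewrite -mpolyC0.
apply: (PD) => //; rewrite -mul_mpolyC; apply: (PM) => //.
rewrite mpolyXE_id; elim/big_rec: _ => [|i q _ Pq]; first by rewrite -mpolyC1.
apply: (PM) => //; elim: (m i) => [|e IH]; first by rewrite expr0 -mpolyC1.
by rewrite exprS; apply: PM.
Qed.

Lemma dhomog_mdeg d f m : f \is d.-homog -> m \in msupp f -> mdeg m = d.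
Proof. by move=> hf; apply: dhomog_mf hf m. Qed.

Lemma dhomog_meval_scale d f v c : f \is d.-homog ->
  f.@[fun i => c * v i] = c ^+ d * f.@[v].
Proof.
move=> hf; rewrite !mevalE mulr_sumr big_seq [RHS]big_seq.
apply: eq_bigr => m mf; rewrite mulrCA; congr (_ * _).
rewrite -(dhomog_mdeg hf mf) mdegE -prodrXr -big_split /=.
by apply: eq_bigr => i _; rewrite exprMn.
Qed.

Lemma dhomog_mderiv d f i : f \is d.-homog -> f^`M(i) \is (d.-1).-homog.
Proof.
move=> hf; rewrite [f]mpolyE linear_sum /= big_seq; apply: rpred_sum => m mf.
rewrite linearZ /= mderivX; apply: rpredZ.
have [->|mi] := posnP (m i); first by rewrite scale0r rpred0.
apply: rpredZ; rewrite dhomogX; apply/eqP.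
have le1 : (U_(i) <= m)%MM by rewrite lep1mP -lt0n.
by rewrite -(dhomog_mdeg hf mf) -{2}(submK le1) mdegD mdeg1 addn1.
Qed.

Lemma euler_homog d f : f \is d.-homog -> \sum_i 'X_i * f^`M(i) = d%:R *: f.
Proof.
move=> hf; rewrite [in LHS](mpolyE f) [in RHS](mpolyE f).
under eq_bigr do rewrite linear_sum /= mulr_sumr.
rewrite exchange_big scaler_sumr /= big_seq [RHS]big_seq.
apply: eq_bigr => m mf; rewrite -(dhomog_mdeg hf mf) mdegE.
under eq_bigr do rewrite linearZ /= mderivX -scalerAr -scalerAr scalerA.
rewrite scalerA natr_sum mulr_suml scaler_suml; apply: eq_bigr => i _.
have [->|mi] := posnP (m i); first by rewrite mulr0 mul0r !scale0r.
have le1 : (U_(i) <= m)%MM by rewrite lep1mP -lt0n.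
by rewrite -mpolyXD addmC (submK le1) mulrC.
Qed.

Lemma euler_meval d f v : f \is d.-homog ->
  \sum_i v i * f^`M(i).@[v] = d%:R * f.@[v].
Proof.
move=> /euler_homog/(congr1 (meval v)); rewrite mevalZ => <-.
by rewrite raddf_sum; apply: eq_bigr => i _ /=; rewrite mevalM mevalXU.
Qed.

Lemma pihomog_mull d e f g : f \is d.-homog ->
  pihomog mdeg (d + e) (f * g) = f * pihomog mdeg e g.
Proof.
(* The bound exceeds [e] so that the component of degree [e] is among the summands even when
   [msize g] is small. *)
move=> hf; pose N := maxn (msize g) e.+1.
have leN : (e < N)%N by rewrite leq_maxr.
rewrite {1}[g](pihomog_partitionE (leq_maxl (msize g) e.+1)) mulr_sumr linear_sum /=.
rewrite (bigD1 (Ordinal leN)) //= pihomog_dE; last first.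
  by apply: dhomogM => //; apply: pihomogP.
rewrite big1 ?addr0 // => i ie; apply: (pihomog_ne0 (mf := mdeg) (d := (d + i)%N)).
  by rewrite eqn_add2l.
by apply: dhomogM => //; apply: pihomogP.
Qed.

(** Divisibility provides an arbitrary cofactor; comparing components of degree [d + e] replaces it
    by a form. *)
Lemma dhomog_quotient d e f g h : f \is d.-homog -> g \is (d + e).-homog ->
  g = f * h -> g = f * pihomog mdeg e h.
Proof. by move=> hf hg eg; rewrite -(pihomog_mull e h hf) -eg pihomog_dE. Qed.

Lemma meval_pihomog f v :
  (forall d, (pihomog mdeg d f).@[v] = 0) -> f.@[v] = 0.
Proof.
move=> hf; rewrite [f](pihomog_partitionE (leqnn (msize f))) raddf_sum big1 //.
by move=> i _; apply: hf.
Qed.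

Lemma dhomog_msizeE d f : f \is d.-homog -> f != 0 -> msize f = d.+1.
Proof.
move=> hf f0; have /(dhomog_uniq f0 hf) -> := dhomog_msize hf.
by rewrite prednK // lt0n msize_poly_eq0.
Qed.

(** * Pullback to a parametrized line, and vanishing of polynomials over an infinite field *)

Definition restr (A B : 'I_n -> k) f : {poly k} :=
  mmap (@polyC k) (fun i => (A i)%:P + B i *: 'X) f.

HB.instance Definition _ A B := GRing.RMorphism.copy (restr A B)
  (mmap (@polyC k) (fun i => (A i)%:P + B i *: 'X)).

Lemma restrC A B c : restr A B c%:MP = c%:P.
Proof. by rewrite /restr mmapC. Qed.

Lemma restrX A B i : restr A B 'X_i = (A i)%:P + B i *: 'X.
Proof. by rewrite /restr mmapX mmap1U. Qed.

Lemma restrZ A B c f : restr A B (c *: f) = c *: restr A B f.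
Proof. by rewrite -mul_mpolyC rmorphM /= restrC mul_polyC. Qed.

Lemma horner_restr A B f y : (restr A B f).[y] = f.@[fun i => A i + y * B i].
Proof.
elim/mpoly_ring_ind: f => [c|i|f g IHf IHg|f g IHf IHg].
- by rewrite restrC hornerC mevalC.
- by rewrite restrX hornerD hornerC hornerZ hornerX mevalXU mulrC.
- by rewrite rmorphD /= hornerD IHf IHg rmorphD.
- by rewrite rmorphM /= hornerM IHf IHg rmorphM.
Qed.

Lemma deriv_restr A B f :
  (restr A B f)^`() = \sum_i B i *: restr A B (f^`M(i)).
Proof.
elim/mpoly_ring_ind: f => [c|i|f g IHf IHg|f g IHf IHg].
- rewrite restrC derivC big1 // => i _.
  by rewrite mderivC rmorph0 scaler0.
- rewrite restrX derivD derivC derivZ derivX add0r (bigD1 i) //=.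
  rewrite mderivX big1 => [|j ij]; last first.
    by rewrite mderivX mnm1E eq_sym (negbTE ij) scale0r rmorph0 scaler0.
  rewrite mnm1E eqxx scale1r addr0; congr (_ *: _).
  suff -> : (U_(i) - U_(i) = 0 :> 'X_{1..n})%MM by rewrite mpolyX0 rmorph1.
  by apply/mnmP => j; rewrite mnmBE subnn mnm0E.
- rewrite rmorphD /= derivD IHf IHg -big_split; apply: eq_bigr => i _ /=.
  by rewrite mderivD rmorphD scalerDr.
- rewrite rmorphM /= derivM IHf IHg mulr_suml mulr_sumr -big_split.
  apply: eq_bigr => i _ /=.
  by rewrite mderivM rmorphD !rmorphM /= scalerDr -scalerAl -scalerAr.
Qed.

Lemma size_restr A B d f : f \is d.-homog -> (size (restr A B f) <= d.+1)%N.
Proof.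
move=> hf; rewrite /restr /mmap big_seq.
apply: (leq_trans (size_sum _ _ _)); apply/bigmax_leqP_seq => m _ mf.
rewrite mul_polyC; apply: (leq_trans (size_scale_leq _ _)).
rewrite -(dhomog_mdeg hf mf) mdegE /mmap1; elim/big_rec2: _ => [|i e q _ IH].
  by rewrite size_poly1.
apply: (leq_trans (size_polyMleq _ _)).
suff : (size (((A i)%:P + B i *: 'X) ^+ m i)%R <= (m i).+1)%N.
  move=> H; have := leq_add H IH; rewrite addSn addnS.
  by case: (_ + _)%N => //= ?; rewrite ltnS.
elim: (m i) => [|r IHr]; first by rewrite expr0 size_poly1.
rewrite exprS; apply: (leq_trans (size_polyMleq _ _)).
have lin2 : (size ((A i)%:P + B i *: 'X)%R <= 2)%N.
  apply: (leq_trans (size_polyD _ _)); rewrite geq_max.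
  rewrite (leq_trans (size_polyC_leq1 _)) //=.
  by rewrite (leq_trans (size_scale_leq _ _)) // size_polyX.
by rewrite -ltnS; move: (leq_add lin2 IHr); case: (_ + _)%N.
Qed.

Hypothesis char0 : [pchar k] =i pred0.
Hypothesis k_inf : forall N : nat, exists s : seq k, uniq s /\ size s = N.

Lemma natk_eq0 d : (d%:R == 0 :> k) = (d == 0%N).
Proof. by have /pcharf0P -> := char0. Qed.

Lemma poly_eval_eq0 (p : {poly k}) : (forall y, p.[y] = 0) -> p = 0.
Proof.
move=> p0; have [s [us ss]] := k_inf (size p).
apply: (roots_geq_poly_eq0 (rs := s)) => //; last by rewrite ss.
by apply/allP => y _; rewrite /root p0.
Qed.

Lemma mderiv_eq0 f : (forall i, f^`M(i) = 0) -> f = (f@_0)%:MP.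
Proof.
move=> df; apply/mpolyP => m; rewrite mcoeffC.
have [->|m0] := eqVneq m 0%MM; first by rewrite mulr1.
have /existsP[i mi] : [exists i, m i != 0%N].
  by apply: contraNT m0 => /existsPn h; apply/eqP/mnmP => i; rewrite mnm0E; apply/eqP/negPn.
have le1 : (U_(i) <= m)%MM by rewrite lep1mP.
have /eqP := congr1 (mcoeff (m - U_(i))) (df i); rewrite mcoeff_mderiv mcoeff0 submK //.
by rewrite -[X in X == 0]mulr_natr mulf_eq0 natk_eq0 orbF mulr0 => /eqP.
Qed.

Lemma msize_mderiv_lt f i : f != 0 -> (msize f^`M(i) < msize f)%N.
Proof.
move=> f0; rewrite [msize f^`M(i)]msizeE (mpolySpred _ f0) ltnS.
apply/bigmax_leqP_seq => m; rewrite mcoeff_msupp mcoeff_mderiv => h _.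
rewrite -ltnS -mpolySpred //.
have /msize_mdeg_lt : (m + U_(i))%MM \in msupp f.
  by rewrite mcoeff_msupp; apply: contraNneq h => ->; rewrite mul0rn.
by rewrite mdegD mdeg1 addn1.
Qed.

(** Induction on the size. Along each coordinate direction the restriction has infinitely many
    zeros, so it is 0 and the partial derivative vanishes everywhere. By induction all partial
    derivatives are 0, and in characteristic zero [f] is constant. *)
Lemma meval_all0 f : (forall v, f.@[v] = 0) -> f = 0.
Proof.
have [N] := ubnP (msize f); elim: N f => // N IH f lN f0.
have [//|fn0] := eqVneq f 0.
suff df i : f^`M(i) = 0.
  by have ef := mderiv_eq0 df; move: (f0 (fun=> 0)); rewrite ef mevalC => ->; rewrite mpolyC0.
apply: IH => [|v]; first exact: leq_trans (msize_mderiv_lt i fn0) _.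
have r0 : restr v (fun j => (j == i)%:R) f = 0.
  by apply: poly_eval_eq0 => y; rewrite horner_restr.
have := deriv_restr v (fun j => (j == i)%:R) f.
rewrite r0 deriv0 (bigD1 i) //= big1 ?addr0 ?eqxx ?scale1r; last first.
  by move=> j /negbTE ->; rewrite scale0r.
move/(congr1 (horner^~ 0)); rewrite horner0 horner_restr => /esym <-.
by apply: meval_eq => j; rewrite mul0r addr0.
Qed.

Lemma meval_neq0 f : f != 0 -> exists v : {ffun 'I_n -> k}, f.@[v] != 0.
Proof.
move=> f0; apply: NNPP => h; case/negP: f0; apply/eqP/meval_all0 => v.
have [//|fv] := eqVneq f.@[v] 0; case: h; exists [ffun i => v i].
by under meval_eq do rewrite ffunE.
Qed.

End Forms.

(** * Points and lines of the plane *)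

Section Plane.
Variable k : fieldType.
Implicit Types (l m p q v A B : vec3 k) (f g h : {mpoly k[3]}).

Definition dot l p : k := \sum_(i < 3) l i * p i.

Definition lin l : {mpoly k[3]} := \sum_(i < 3) l i *: 'X_i.

Definition mkvec (a b c : k) : vec3 k := [ffun i : 'I_3 => [:: a; b; c]`_i].

Local Notation o0 := (ord0 : 'I_3).
Local Notation o1 := (lift ord0 ord0 : 'I_3).
Local Notation o2 := (lift ord0 (lift ord0 ord0) : 'I_3).

Lemma ord3P (P : 'I_3 -> Prop) : P o0 -> P o1 -> P o2 -> forall i, P i.
Proof.
move=> P0 P1 P2 [[|[|[|//]]] hi].
- by have -> : Ordinal hi = o0 by apply: val_inj.
- by have -> : Ordinal hi = o1 by apply: val_inj.
- by have -> : Ordinal hi = o2 by apply: val_inj.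
Qed.

Lemma dotE l p : dot l p = l o0 * p o0 + l o1 * p o1 + l o2 * p o2.
Proof. by rewrite /dot !big_ord_recl big_ord0 addr0 addrA. Qed.

Lemma dotC l p : dot l p = dot p l.
Proof. by rewrite !dotE; ring. Qed.

Definition cross l m : vec3 k :=
  mkvec (l o1 * m o2 - l o2 * m o1) (l o2 * m o0 - l o0 * m o2)
        (l o0 * m o1 - l o1 * m o0).

Lemma dot_crossl l m : dot l (cross l m) = 0.
Proof. by rewrite dotE !ffunE /=; ring. Qed.

Lemma dot_crossr l m : dot m (cross l m) = 0.
Proof. by rewrite dotE !ffunE /=; ring. Qed.

Lemma cross_span l m v : dot l v = 0 -> dot m v = 0 ->
  forall i j, v i * cross l m j = v j * cross l m i.
Proof.
rewrite !dotE => lv mv i j; apply/eqP; rewrite -subr_eq0; apply/eqP; move: i j.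
(* Each minor is a combination of the two incidence equations with coefficients taken from [l] and
   [m]. *)
have E a b : a * (l o0 * v o0 + l o1 * v o1 + l o2 * v o2) +
   b * (m o0 * v o0 + m o1 * v o1 + m o2 * v o2) = 0.
  by rewrite lv mv !mulr0 addr0.
apply: ord3P; apply: ord3P; rewrite !ffunE /=; first by ring.
- rewrite -(E (- m o2) (l o2)); ring.
- rewrite -(E (m o1) (- l o1)); ring.
- rewrite -(E (m o2) (- l o2)); ring.
- by ring.
- rewrite -(E (- m o0) (l o0)); ring.
- rewrite -(E (- m o1) (l o1)); ring.
- rewrite -(E (m o0) (- l o0)); ring.
- by ring.
Qed.

Lemma minor_cross l m : (forall i, cross l m i = 0) ->
  forall i j, l i * m j = l j * m i.
Proof.
move=> c0; have := c0 o0; have := c0 o1; have := c0 o2; rewrite !ffunE /=.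
move=> /subr0_eq e2 /subr0_eq e1 /subr0_eq e0.
by apply: ord3P; apply: ord3P.
Qed.

Lemma minor_proportional l m : nonzero3 l -> nonzero3 m ->
  (forall i j, l i * m j = l j * m i) -> proportional l m.
Proof.
move=> [i li] [j mj] h; exists (m i / l i); split; last first.
  by move=> r; rewrite mulrAC [m i * _]mulrC -(h i r) mulrAC mulfV // mul1r.
apply: mulf_neq0; last by rewrite invr_eq0.
apply: contraNneq mj => mi; have := h i j; rewrite mi mulr0 => /eqP.
by rewrite mulf_eq0 (negbTE li).
Qed.

Lemma cross_neq0 l m : nonzero3 l -> nonzero3 m -> ~ proportional l m ->
  nonzero3 (cross l m).
Proof.
move=> nl nm lm; apply: NNPP => h; apply: lm; apply: minor_proportional => //.
apply: minor_cross => i; apply/eqP/negPn/negP => ci; apply: h; by exists i.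
Qed.

Lemma proportional_sym p q : proportional p q -> proportional q p.
Proof.
move=> [c [c0 h]]; exists c^-1; rewrite invr_eq0; split=> // i.
by rewrite h mulrA mulVf // mul1r.
Qed.

Lemma dot_proportional l p q : proportional p q -> dot l p = 0 -> dot l q = 0.
Proof.
move=> [c [_ h]] lp; rewrite -[RHS](mulr0 c) -lp /dot mulr_sumr.
by apply: eq_bigr => i _; rewrite h mulrCA.
Qed.

Lemma on_two_lines l m p q : nonzero3 (cross l m) -> nonzero3 p -> nonzero3 q ->
  dot l p = 0 -> dot m p = 0 -> dot l q = 0 -> dot m q = 0 -> proportional p q.
Proof.
move=> [r cr] np nq lp mp lq mq; apply: minor_proportional => // i j.
have hp := cross_span lp mp; have hq := cross_span lq mq.
by apply: (mulIf cr); rewrite -mulrA (hq j r) mulrCA (hp i j) mulrCA -(hq i r) mulrA.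
Qed.

Lemma separating_line p q : nonzero3 p -> nonzero3 q -> ~ proportional p q ->
  exists l, dot l p = 0 /\ dot l q != 0.
Proof.
move=> np nq pq; have [r cr] := cross_neq0 np nq pq.
(* The line joins [p] to the r-th basis point; its value at [q] is a determinant equal, up to sign,
   to the r-th coordinate of [cross p q]. *)
exists (cross p [ffun i => (i == r)%:R]); split; first by rewrite dotC dot_crossl.
apply: contra cr => /eqP; rewrite dotE !ffunE /= => h; apply/eqP/oppr_inj.
by rewrite oppr0 -[RHS]h; move: r {h}; apply: ord3P; rewrite /=; ring.
Qed.

Lemma lin_meval l p : (lin l).@[p] = dot l p.
Proof.
by rewrite raddf_sum; apply: eq_bigr => i _ /=; rewrite mevalZ mevalXU.
Qed.

Lemma lin_homog l : lin l \is 1.-homog.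
Proof.
apply: rpred_sum => i _; apply: rpredZ; rewrite dhomogX; apply/eqP; exact: mdeg1.
Qed.

Lemma mderiv_lin l i : (lin l)^`M(i) = (l i)%:MP.
Proof.
rewrite linear_sum /= (bigD1 i) //= mderivZ mderivX mnm1E eqxx scale1r big1.
  rewrite addr0 -mul_mpolyC.
  suff -> : (U_(i) - U_(i) = 0 :> 'X_{1..3})%MM by rewrite mpolyX0 mulr1.
  by apply/mnmP => j; rewrite mnmBE subnn mnm0E.
by move=> j ji; rewrite mderivZ mderivX mnm1E (negbTE ji) scale0r scaler0.
Qed.

Lemma lin_neq0 l : nonzero3 l -> lin l != 0.
Proof.
move=> [i li]; apply: contraNneq li => /(congr1 (mderiv i)).
by rewrite mderiv_lin linear0 => /eqP; rewrite mpolyC_eq0.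
Qed.

Lemma lin_of_homog1 f : f \is 1.-homog -> exists l, f = lin l.
Proof.
move=> hf; exists [ffun i => f@_U_(i)]; apply/mpolyP => m.
rewrite raddf_sum /=; under eq_bigr do rewrite mcoeffZ mcoeffX ffunE.
have [/eqP/mdeg1P[i /eqP ->]|m1] := eqVneq (mdeg m) 1%N.
  rewrite (bigD1 i) //= eqxx mulr1 big1 ?addr0 // => j /negbTE ij.
  suff -> : (U_(j) == U_(i))%MM = false by rewrite mulr0.
  apply: contraFF ij => /eqP/mnmP/(_ i); rewrite !mnm1E eqxx.
  by case: (j == i).
rewrite (dhomog_nemf_coeff hf m1) big1 // => i _.
suff -> : (U_(i) == m)%MM = false by rewrite mulr0.
by apply: contraNF m1 => /eqP <-; rewrite mdeg1.
Qed.

(** * Divisibility by a linear form *)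

Definition mdvd f g := exists w, g = f * w.

(** Pullback along v -> v - (l.v) c, which projects onto the line [l] from the point [c] when
    [dot l c = 1]. It is then a ring morphism whose kernel is the ideal of [lin l], so primality of
    [lin l] follows from the polynomial ring being a domain. *)
Definition line_proj l (c : vec3 k) f : {mpoly k[3]} :=
  mmap (@mpolyC 3 k) (fun i => 'X_i - c i *: lin l) f.

HB.instance Definition _ l c := GRing.RMorphism.copy (line_proj l c)
  (mmap (@mpolyC 3 k) (fun i => 'X_i - c i *: lin l)).

Lemma line_projX l c i : line_proj l c 'X_i = 'X_i - c i *: lin l.
Proof. by rewrite /line_proj mmapX mmap1U. Qed.

Lemma line_projC l c a : line_proj l c a%:MP = a%:MP.
Proof. by rewrite /line_proj mmapC. Qed.

Lemma line_proj_mod l c f : mdvd (lin l) (f - line_proj l c f).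
Proof.
elim/mpoly_ring_ind: f => [a|i|f g [u eu] [w ew]|f g [u eu] [w ew]].
- by exists 0; rewrite line_projC subrr mulr0.
- exists (c i)%:MP; rewrite line_projX opprB addrCA subrr addr0.
  by rewrite -mul_mpolyC mulrC.
- exists (u + w); rewrite mulrDr -eu -ew rmorphD /=; ring.
- exists (u * g + line_proj l c f * w); rewrite mulrDr mulrA -eu.
  rewrite [lin l * (_ * w)]mulrCA -ew rmorphM /=.
  ring.
Qed.

Lemma line_proj_lin l c m : line_proj l c (lin m) = lin m - dot m c *: lin l.
Proof.
rewrite raddf_sum /dot scaler_suml -sumrB; apply: eq_bigr => i _ /=.
rewrite -!mul_mpolyC rmorphM /= line_projC line_projX mulrBr -mul_mpolyC.
by rewrite mpolyCM mulrA.
Qed.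

Lemma exists_dot1 l : nonzero3 l -> exists c, dot l c = 1.
Proof.
move=> [i li]; exists [ffun j => (j == i)%:R / l i].
rewrite /dot (bigD1 i) //= ffunE eqxx mul1r mulfV // big1 ?addr0 // => j /negbTE ji.
by rewrite ffunE ji mul0r mulr0.
Qed.

Lemma line_projP l c f : dot l c = 1 ->
  mdvd (lin l) f <-> line_proj l c f = 0.
Proof.
move=> lc; split=> [[w ->]|h].
  by rewrite rmorphM /= line_proj_lin lc scale1r subrr mul0r.
by have := line_proj_mod l c f; rewrite h subr0.
Qed.

Lemma lin_prime l f g : nonzero3 l -> mdvd (lin l) (f * g) ->
  mdvd (lin l) f \/ mdvd (lin l) g.
Proof.
move=> /exists_dot1[c lc] /(line_projP _ lc); rewrite rmorphM /= => /eqP.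
by rewrite mulf_eq0 => /orP[]/eqP/(line_projP _ lc); [left|right].
Qed.

Lemma mdvd_lin_meval l f p : dot l p = 0 -> mdvd (lin l) f -> f.@[p] = 0.
Proof. by move=> lp [w ->]; rewrite mevalM lin_meval lp mul0r. Qed.

Lemma mdvd_linP l m : mdvd (lin l) (lin m) -> nonzero3 l -> nonzero3 m -> proportional l m.
Proof.
move=> h nl nm; apply: minor_proportional => //; apply: minor_cross => i.
(* [lin m] vanishes at the point of [l] obtained from the i-th basis vector, where its value is
   minus the i-th coordinate of [cross l m]. *)
have := mdvd_lin_meval (dot_crossl l [ffun j => (j == i)%:R]) h.
rewrite lin_meval dotE !ffunE /=; move=> h'.
apply: oppr_inj; rewrite oppr0 -[RHS]h'; move: i {h'}.
by apply: ord3P => /=; ring.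
Qed.

Lemma mdvd_lin_prod (I : eqType) (r : seq I) (F : I -> {mpoly k[3]}) l :
  nonzero3 l -> mdvd (lin l) (\prod_(i <- r) F i) ->
  exists2 i, i \in r & mdvd (lin l) (F i).
Proof.
move=> nl; elim: r => [|i r IH].
  rewrite big_nil => -[w /esym ew]; exfalso.
  have [c lc] := exists_dot1 nl; have : mdvd (lin l) 1 by exists w.
  move/(line_projP _ lc); rewrite rmorph1 => /eqP; by rewrite oner_eq0.
rewrite big_cons => /(lin_prime nl)[h|/IH[j jr h]]; first by exists i; rewrite ?mem_head.
by exists j; rewrite // in_cons jr orbT.
Qed.

(** Vanishing to order two; for a form and a nonzero [p] it amounts to membership in the square of
    the ideal of [p]. *)
Definition sing p f := f.@[p] = 0 /\ forall i, f^`M(i).@[p] = 0.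

Hypothesis char0 : [pchar k] =i pred0.
Hypothesis k_inf : forall N : nat, exists s : seq k, uniq s /\ size s = N.

(** For each point the incidence with the line (1, s, s^2) is a nonzero polynomial in s; the product
    of these polynomials has a non-root. *)
Lemma moment_line (P : seq (vec3 k)) : (forall p, p \in P -> nonzero3 p) ->
  exists s : k, forall p, p \in P -> dot (mkvec 1 s (s ^+ 2)) p != 0.
Proof.
move=> nP; pose F p : {poly k} := (p o0)%:P + p o1 *: 'X + p o2 *: 'X^2.
have F0 p : p \in P -> F p != 0.
  move=> /nP[i pi]; apply: contraNneq pi => Fp.
  have Fi j : p j = (F p)`_j.
    rewrite !coefD !coefZ coefC coefX coefXn.
    by move: j; apply: ord3P => /=; ring.
  by rewrite Fi Fp coef0.
pose Q := \prod_(p <- P) F p.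
have Q0 : Q != 0 by rewrite /Q prodf_seq_neq0; apply/allP => p /F0.
have [y Qy] : exists y, Q.[y] != 0.
  apply: NNPP => h; case/negP: Q0; apply/eqP/(poly_eval_eq0 k_inf) => y.
  by have [//|Qy] := eqVneq Q.[y] 0; case: h; exists y.
exists y => p pP; apply: contraNneq Qy => h.
rewrite /Q (big_rem _ pP) /= hornerM.
suff -> : (F p).[y] = 0 by rewrite mul0r.
rewrite -h dotE !ffunE /= !hornerD !hornerZ hornerC hornerX hornerXn; ring.
Qed.

Lemma double_roots_eq0 (p : {poly k}) (s : seq k) : uniq s ->
  (forall y, y \in s -> p.[y] = 0 /\ p^`().[y] = 0) ->
  (size p <= 2 * size s)%N -> p = 0.
Proof.
elim: s p => [|y s IH] p /=; first by move=> _ _; rewrite muln0 leqn0 size_poly_eq0 => /eqP.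
move=> /andP[ys us] h sp; have [py dpy] := h y (mem_head _ _).
have /factor_theorem[q1 eq1] : root p y by apply/rootP.
have /factor_theorem[q eq] : root q1 y.
  apply/rootP; move: dpy; rewrite eq1 derivM derivXsubC hornerD !hornerM.
  by rewrite hornerXsubC subrr mulr0 add0r hornerC mulr1.
have [->|p0] := eqVneq p 0; first by [].
have ep : p = q * ('X - y%:P) ^+ 2 by rewrite eq1 eq expr2 mulrA.
suff q0 : q = 0 by rewrite ep q0 mul0r.
apply: IH => // [z zs|].
  have zy : z - y != 0 by rewrite subr_eq0; apply: contraNneq ys => <-.
  have [|pz dpz] := h z; first by rewrite in_cons zs orbT.
  have qz : q.[z] = 0.
    move/eqP: pz; rewrite ep hornerM horner_exp hornerXsubC mulf_eq0.
    by rewrite expf_eq0 (negbTE zy) orbF => /eqP.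
  split=> //; move/eqP: dpz; rewrite ep derivM hornerD [(q * _).[z]]hornerM qz mul0r addr0.
  by rewrite hornerM horner_exp hornerXsubC mulf_eq0 expf_eq0 (negbTE zy) orbF => /eqP.
have q0 : q != 0 by apply: contraNneq p0 => q0; rewrite ep q0 mul0r.
move: sp; rewrite ep size_Mmonic ?monic_exp ?monicXsubC // size_exp_XsubC.
by rewrite addnS /= addn2 mulnS.
Qed.

Lemma restr_sing A B f y : sing [ffun i => A i + y * B i] f ->
  (restr A B f).[y] = 0 /\ (restr A B f)^`().[y] = 0.
Proof.
have E g : (restr A B g).[y] = g.@[[ffun i => A i + y * B i]].
  by rewrite horner_restr; apply: meval_eq => i; rewrite ffunE.
move=> [f0 df]; rewrite deriv_restr E f0 horner_sum; split=> //.
by rewrite big1 // => i _; rewrite hornerZ E df mulr0.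
Qed.

Lemma sing_scale d f p q : f \is d.-homog -> proportional p q -> sing p f -> sing q f.
Proof.
move=> hf [c [_ h]] [fp dfp].
have E e g : g \is e.-homog -> g.@[p] = 0 -> g.@[q] = 0.
  by move=> hg gp; rewrite (meval_eq _ h) (dhomog_meval_scale _ _ hg) gp mulr0.
split; first exact: E hf _.
by move=> i; apply: E (dhomog_mderiv i hf) _.
Qed.

(** A point of [l] off [m] is a multiple of some A + yB, where [f] vanishes. Multiplying [f] by
    [lin m] also covers the points of [l] on [m]; so [lin l] divides the product, and by primality
    it divides [f]. *)
Lemma restr_line_eq0 l m A B d f : nonzero3 l -> dot l A = 0 -> dot m A != 0 ->
  (forall v, dot l v = 0 -> exists b, forall i, v i = dot m v * A i + b * B i) ->
  f \is d.-homog -> restr A B f = 0 -> mdvd (lin l) f.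
Proof.
move=> nl lA mA span hf r0; have [c lc] := exists_dot1 nl.
have : mdvd (lin l) (lin m * f).
  apply/(line_projP _ lc); apply: (meval_all0 char0 k_inf) => v.
  pose v' : vec3 k := [ffun i => v i - c i * \sum_j l j * v j].
  have pE g : (line_proj l c g).@[v] = g.@[v'].
    elim/mpoly_ring_ind: g => [a|i|f' g IHf IHg|f' g IHf IHg].
    - by rewrite line_projC !mevalC.
    - rewrite line_projX mevalB mevalZ !mevalXU ffunE raddf_sum /=.
      by under eq_bigr do rewrite mevalZ mevalXU.
    - by rewrite rmorphD /= !mevalD IHf IHg.
    - by rewrite rmorphM /= !mevalM IHf IHg.
  have lv' : dot l v' = 0.
    rewrite /dot; under eq_bigr do rewrite ffunE mulrBr mulrA.
    by rewrite sumrB -mulr_suml -/(dot l c) lc mul1r subrr.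
  rewrite pE mevalM lin_meval.
  have [->|mv] := eqVneq (dot m v') 0; first by rewrite mul0r.
  have [b hb] := span v' lv'.
  rewrite (@meval_eq _ _ _ (fun i => dot m v' * (A i + b / dot m v' * B i))); last first.
    by move=> i; rewrite hb mulrDr mulrA mulrCA mulfV // mulr1.
  by rewrite (dhomog_meval_scale _ _ hf) -horner_restr r0 horner0 !mulr0.
case/(lin_prime nl) => // /(mdvd_lin_meval lA); rewrite lin_meval => mA0.
by rewrite mA0 eqxx in mA.
Qed.

(* The vanishing order at the points is 1 or 2 according to [b]. *)
Lemma line_dvd (b : bool) l d f (P : seq (vec3 k)) : nonzero3 l ->
  point_list P -> (forall p, p \in P -> dot l p = 0) -> f \is d.-homog ->
  (forall p, p \in P -> if b then sing p f else f.@[p] = 0) ->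
  (d < b.+1 * size P)%N -> mdvd (lin l) f.
Proof.
move=> nl [nP dP] lP hf fP lt.
have [s ms] := moment_line nP; set m := mkvec _ _ _ in ms.
case eP : P => [|p0 P0]; first by rewrite eP muln0 in lt.
have p0P : p0 \in P by rewrite eP mem_head.
have mp0 := ms p0 p0P.
have nm : nonzero3 m by exists o0; rewrite ffunE oner_eq0.
have lm : ~ proportional l m.
  move=> [c [_ h]]; case/negP: mp0; rewrite /dot; under eq_bigr do rewrite h -mulrA.
  by rewrite -mulr_sumr -/(dot l p0) lP // mulr0.
have nB := cross_neq0 nl nm lm; set B := cross l m in nB.
pose A : vec3 k := [ffun i => p0 i / dot m p0].
have dotZ l' c p : dot l' [ffun i => p i * c] = dot l' p * c.
  by rewrite /dot mulr_suml; apply: eq_bigr => i _; rewrite ffunE mulrA.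
have lA : dot l A = 0 by rewrite dotZ lP // mul0r.
have mA : dot m A = 1 by rewrite dotZ mulfV.
have [r Br] := nB.
(* For [v] on [l], the vector v - (m.v) A is orthogonal to [l] and [m], hence a multiple of [B];
   this is the factor. *)
pose yof v := (v r - dot m v * A r) / B r.
have span v : dot l v = 0 -> forall i, v i = dot m v * A i + yof v * B i.
  move=> lv i; pose w : vec3 k := [ffun j => v j - dot m v * A j].
  have dw l' : dot l' w = dot l' v - dot m v * dot l' A.
    have wE j : w j = v j - dot m v * A j by rewrite ffunE.
    rewrite !(dotE l') !wE; ring.
  have := @cross_span l m w; rewrite !dw lv lA mA mulr1 mulr0 subrr.
  move=> /(_ erefl (subrr _) i r) /(canRL (mulfK Br)) e.
  have wE j : w j = v j - dot m v * A j by rewrite ffunE.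
  by rewrite /yof -wE mulrAC -e wE addrC subrK.
apply: (@restr_line_eq0 l m A B d) => //; first by rewrite mA oner_eq0.
  by move=> v lv; exists (yof v); apply: span.
pose y p := yof p / dot m p.
have pE p : p \in P -> forall i, A i + y p * B i = (dot m p)^-1 * p i.
  move=> pP i; have mp := ms p pP; rewrite [in RHS](span p (lP p pP)).
  by rewrite mulrDr mulrA mulVf // mul1r mulrA [_^-1 * _]mulrC.
have propE p : p \in P -> proportional p [ffun i => A i + y p * B i].
  move=> pP; exists (dot m p)^-1; rewrite invr_eq0 ms //; split=> // i.
  by rewrite ffunE pE.
have uP : uniq [seq y p | p <- P].
  apply/(uniqP 0) => i j; rewrite !inE !size_map => li lj.
  rewrite !(nth_map [ffun=> 0]) // => e; apply/eqP/negPn/negP => ij.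
  apply: (dP i j) => //; set p := nth _ _ i in e *; set q := nth _ _ j in e *.
  have pP : p \in P by apply: mem_nth.
  have qP : q \in P by apply: mem_nth.
  have mp := ms p pP; have mq := ms q qP.
  exists (dot m q / dot m p); rewrite mulf_neq0 ?invr_eq0 //; split=> // a.
  by rewrite -mulrA -pE // e pE // mulrA mulfV // mul1r.
case: b fP lt => fP lt; last first.
  apply: (roots_geq_poly_eq0 (rs := [seq y p | p <- P])) => //.
    apply/allP => _ /mapP[p pP ->]; rewrite /root horner_restr.
    by rewrite (meval_eq _ (pE p pP)) (dhomog_meval_scale _ _ hf) fP // mulr0.
  rewrite size_map; apply: leq_trans (size_restr _ _ hf) _.
  by rewrite mul1n in lt.
apply: (double_roots_eq0 uP); last first.
  by rewrite size_map; apply: leq_trans (size_restr _ _ hf) _.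
move=> _ /mapP[p pP ->]; apply: restr_sing.
exact: sing_scale hf (propE p pP) (fP p pP).
Qed.

End Plane.

(** * Ideals of points and Hilbert functions *)

Section Ideals.
Variable k : fieldType.
Implicit Types (p q v : vec3 k) (f g h : {mpoly k[3]}).

Hypothesis char0 : [pchar k] =i pred0.
Hypothesis k_inf : forall N : nat, exists s : seq k, uniq s /\ size s = N.

Lemma pt_ideal_meval p f : pt_ideal p f -> f.@[p] = 0.
Proof. exact: meval_pihomog. Qed.

Lemma pt_ideal_homog d p f : f \is d.-homog -> f.@[p] = 0 -> pt_ideal p f.
Proof.
move=> hf fp e; have [<-|de] := eqVneq d e; first by rewrite pihomog_dE.
by rewrite (pihomog_ne0 (mf := mdeg) de hf) meval0.
Qed.

Lemma ideal_sq_sing p f : ideal_sq (pt_ideal p) f -> sing p f.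
Proof.
move=> [s [hs ->]]; split.
  rewrite raddf_sum big_seq big1 // => x /hs[h _] /=.
  by rewrite mevalM (pt_ideal_meval h) mul0r.
move=> i; rewrite [_^`M(_)]linear_sum /= raddf_sum big_seq big1 // => x /hs[h1 h2] /=.
rewrite mderivM mevalD !mevalM (pt_ideal_meval h1) (pt_ideal_meval h2).
by rewrite mulr0 mul0r addr0.
Qed.

(** Substituting multiples of ['X_i] according to the coordinates of [p] turns [f] into a multiple
    of its value at [p], that is 0. Any polynomial is congruent to its substitution modulo the forms
    ['X_j - (p j / p i) *: 'X_i]. *)
Lemma homog_vanish_decomp d p i f : p i != 0 -> f \is (d.+1).-homog -> f.@[p] = 0 ->
  exists h : 'I_3 -> {mpoly k[3]}, (forall j, h j \is d.-homog) /\
    f = \sum_j ('X_j - (p j / p i) *: 'X_i) * h j.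
Proof.
move=> pi hf fp; pose y j : {mpoly k[3]} := 'X_j - (p j / p i) *: 'X_i.
pose tau := mmap (@mpolyC 3 k) (fun j => (p j / p i) *: 'X_i).
have tf0 : tau f = 0.
  apply: (meval_all0 char0 k_inf) => v.
  suff E g : (tau g).@[v] = g.@[fun j => v i / p i * p j].
    by rewrite E (dhomog_meval_scale _ _ hf) fp mulr0.
  elim/mpoly_ring_ind: g => [a|j|g g' IHg IHg'|g g' IHg IHg'].
  - by rewrite /tau mmapC !mevalC.
  - by rewrite /tau mmapX mmap1U mevalZ !mevalXU; ring.
  - by rewrite /tau !rmorphD /= IHg IHg'.
  - by rewrite /tau !rmorphM /= IHg IHg'.
have [h eh] : exists h : 'I_3 -> {mpoly k[3]}, f - tau f = \sum_j y j * h j.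
  move: {hf fp tf0} f; elim/mpoly_ring_ind => [a|j|g g' [u eu] [w ew]|g g' [u eu] [w ew]].
  - exists (fun=> 0); rewrite /tau mmapC subrr big1 // => j _; exact: mulr0.
  - exists (fun j' => (j' == j)%:R); rewrite (bigD1 j) //= eqxx mulr1 big1 => [|j' /negbTE ->].
      by rewrite addr0 /tau mmapX mmap1U.
    by rewrite mulr0.
  - exists (fun j => u j + w j); under eq_bigr do rewrite mulrDr.
    rewrite big_split /= -eu -ew /tau rmorphD /=; ring.
  - exists (fun j => u j * g' + tau g * w j); under eq_bigr do rewrite mulrDr mulrA mulrCA.
    rewrite big_split /= -mulr_suml -mulr_sumr -eu -ew /tau rmorphM /=; ring.
exists (fun j => pihomog mdeg d (h j)); split=> [j|]; first exact: pihomogP.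
have hy j : y j \is 1.-homog.
  by rewrite /y rpredB ?rpredZ // dhomogX; apply/eqP; exact: mdeg1.
under eq_bigr do rewrite -(pihomog_mull _ _ (hy _)).
by rewrite -linear_sum /= -eh tf0 subr0 pihomog_dE.
Qed.

(** In the decomposition of [f] the i-th generator is 0, and for j other than i the j-th derivative
    of [f] at [p] is [h j] evaluated there. So both factors of every remaining term lie in the ideal
    of [p]. *)
Lemma sing_ideal_sq d p f : nonzero3 p -> f \is d.-homog -> sing p f ->
  ideal_sq (pt_ideal p) f.
Proof.
move=> [i pi] hf [fp dfp]; case: d hf => [|d] hf.
  exists [::]; split=> //; rewrite big_nil.
  have [//|f0] := eqVneq f 0.
  have /msize1_polyC ef : (msize f <= 1)%N by rewrite (dhomog_msizeE hf f0).
  by move: fp; rewrite ef mevalC => ->; rewrite mpolyC0.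
have [h [hh ef]] := homog_vanish_decomp pi hf fp.
pose y j : {mpoly k[3]} := 'X_j - (p j / p i) *: 'X_i.
have yp j : (y j).@[p] = 0.
  by rewrite mevalB mevalZ !mevalXU divfK // subrr.
have dX a b : ('X_b : {mpoly k[3]})^`M(a).@[p] = (a == b)%:R.
  rewrite mderivX mevalZ mnm1E eq_sym; have [->|ab] := eqVneq a b; last by rewrite mul0r.
  suff -> : (U_(b) - U_(b) = 0 :> 'X_{1..3})%MM by rewrite mpolyX0 meval1 mulr1.
  by apply/mnmP => j; rewrite mnmBE subnn mnm0E.
have hp j : j != i -> (h j).@[p] = 0.
  move=> ji; rewrite -[RHS](dfp j) {1}ef [_^`M(_)]linear_sum /= raddf_sum (bigD1 j) //= big1.
    rewrite mderivM mevalD !mevalM -/(y j) yp mul0r !addr0 mderivB mevalB mderivZ mevalZ.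
    by rewrite !dX eqxx (negbTE ji) mulr0 subr0 mul1r.
  move=> b bj; rewrite mderivM mevalD !mevalM -/(y b) yp mul0r addr0 mderivB mevalB.
  by rewrite mderivZ mevalZ !dX (negbTE ji) eq_sym (negbTE bj) mulr0 subr0 mul0r.
exists [seq (y j, h j) | j <- enum 'I_3 & j != i]; split.
  move=> x /mapP[j]; rewrite mem_filter => /andP[ji _] -> /=; split.
    apply: (@pt_ideal_homog 1) => //; rewrite rpredB ?rpredZ // dhomogX; apply/eqP; exact: mdeg1.
  exact: pt_ideal_homog (hh j) (hp j ji).
rewrite big_map big_filter big_enum_cond /= ef [LHS](bigD1 i) //= mulfV // scale1r subrr.
by rewrite mul0r add0r.
Qed.

Lemma fat_idealP d S f : f \is d.-homog ->
  fat_ideal S f <-> (forall p, nonzero3 p -> S p -> sing p f).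
Proof.
by move=> hf; split=> h p np Sp; [apply/ideal_sq_sing/h | apply: (sing_ideal_sq np hf); apply: h].
Qed.

Lemma red_idealP d S f : f \is d.-homog ->
  red_ideal S f <-> (forall p, nonzero3 p -> S p -> f.@[p] = 0).
Proof.
by move=> hf; split=> h p np Sp; [apply/pt_ideal_meval/h | apply: (pt_ideal_homog hf); apply: h].
Qed.

Lemma dim_homog d : \dim {: dhomog 3 k d} = 'C(d.+2, 2).
Proof. rewrite dimvf -[d.+2]addn2 -(bin_sub (leq_addl d 2)) addnK; reflexivity. Qed.

(** [hilb] chooses some number satisfying [hilb_is]. Images of a basis modulo [I] form a basis of
    the image of [phi], so such a number is unique; lifting a basis of the image shows that it
    exists. *)
Lemma hilb_limg (I : {mpoly k[3]} -> Prop) d (W : vectType k)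
    (phi : 'Hom(dhomog 3 k d, W)) :
  (forall f : dhomog 3 k d, I f <-> phi f = 0) -> hilb I d = \dim (limg phi).
Proof.
move=> Iphi.
have IphiZ n (s : n.-tuple {mpoly k[3]}) (hs : forall i, tnth s i \is d.-homog) (c : 'I_n -> k) :
    \sum_(i < n) c i *: tnth s i = val (\sum_(i < n) c i *: DHomog (hs i)).
  by rewrite /= raddf_sum; apply: eq_bigr.
have hilbU n : hilb_is I d n -> n = \dim (limg phi).
  move=> [s [hs s_free s_span]]; pose b := [tuple phi (DHomog (hs i)) | i < n].
  have b_tnth (i : 'I_n) : b`_i = phi (DHomog (hs i)).
    by rewrite -tnth_nth tnth_mktuple.
  suff /vector.size_basis -> : basis_of (limg phi) b by [].
  rewrite basisEfree size_tuple; apply/and3P; split.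
  - apply/freeP => c hc; apply: s_free; rewrite (IphiZ _ s hs); apply/Iphi.
    rewrite linear_sum -[RHS]hc; apply: eq_bigr => i _.
    by rewrite linearZ b_tnth.
  - by apply/span_subvP => _ /codomP[i ->]; rewrite memv_img ?memvf.
  rewrite -[X in (_ <= X)%N](size_tuple b); apply: leq_trans (dim_span b).
  apply/dimvS/subvP => _ /memv_imgP[f _ ->].
  have [c] := s_span f (valP f); rewrite (IphiZ _ s hs) -raddfB => /Iphi/eqP.
  rewrite linearB subr_eq0 => /eqP ->; rewrite linear_sum rpred_sum // => i _.
  rewrite linearZ; apply: rpredZ; rewrite /= -b_tnth; apply: memv_span.
  by rewrite mem_nth // size_tuple.
apply: hilbU; apply: epsilon_spec; exists (\dim (limg phi)).
set n := \dim _; pose b := vbasis (limg phi).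
pose s' (i : nat) := (phi^-1)%VF b`_i.
pose s := [tuple val (s' (i : nat)) | i < n].
have hs i : tnth s i \is d.-homog by rewrite tnth_mktuple; apply: valP.
have phis (i : 'I_n) : phi (DHomog (hs i)) = b`_i.
  have -> : DHomog (hs i) = s' i by apply: val_inj; rewrite /= tnth_mktuple.
  by rewrite limg_lfunVK // vbasis_mem // mem_nth // size_tuple.
exists s; split=> //.
- move=> c; rewrite (IphiZ _ s hs) => /Iphi; rewrite linear_sum /= => hc.
  have /freeP := basis_free (vbasisP (limg phi)); apply.
  by rewrite -[RHS]hc; apply: eq_bigr => i _; rewrite linearZ /= phis.
- move=> f hf; have /coord_vbasis ef := memv_img phi (memvf (DHomog hf)).
  exists (fun i => coord b i (phi (DHomog hf))).
  rewrite (IphiZ _ s hs) -[f]/(val (DHomog hf)) -raddfB; apply/Iphi.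
  rewrite linearB /= {1}ef linear_sum /=; apply/eqP; rewrite subr_eq0; apply/eqP.
  by apply: eq_bigr => i _; rewrite linearZ /= phis.
Qed.

End Ideals.

(** * Binomial identities for the dimension counts *)

Lemma binS2 n : 'C(n.+1, 2) = ('C(n, 2) + n)%N.
Proof. by rewrite binS bin1. Qed.

(** The dimension count in degree 2e+1 = 2t-3: three conditions for each of the binom(e+2, 2) points
    leave binom(e+1, 2). *)
Lemma bin2_regularity e : ('C(e.+1, 2) + 3 * 'C(e.+2, 2) = 'C((e + e).+3, 2))%N.
Proof.
have E n : ('C(n.+1, 2) * 2 = n.+1 * n)%N.
  rewrite bin2 muln2; have := odd_double_half (n.+1 * n).
  by rewrite oddM /=; case: (odd n).
by have := E (e + e).+2; have := E e.+1; have := E e; lia.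
Qed.

(** * Linear systems of curves singular along a set of points *)

Section Systems.
Variable k : fieldType.
Implicit Types (p q v : vec3 k) (f g h : {mpoly k[3]}).

Hypothesis char0 : [pchar k] =i pred0.
Hypothesis k_inf : forall N : nat, exists s : seq k, uniq s /\ size s = N.

Definition mulhom r d g (hg : g \is r.-homog) (f : dhomog 3 k d) : dhomog 3 k (r + d) :=
  DHomog (dhomogM hg (valP f)).

Lemma mulhom_linear r d g (hg : g \is r.-homog) : linear (@mulhom r d g hg).
Proof. by move=> c f f'; apply: val_inj; rewrite /= mulrDr scalerAr. Qed.

HB.instance Definition _ r d g (hg : g \is r.-homog) :=
  GRing.isLinear.Build k _ _ _ (@mulhom r d g hg) (mulhom_linear hg).

Lemma dim_mulhom r d g (hg : g \is r.-homog) (U : {vspace dhomog 3 k d}) : g != 0 ->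
  \dim (linfun (mulhom hg) @: U) = \dim U.
Proof.
move=> g0; apply: limg_dim_eq; apply/eqP; rewrite -subv0; apply/subvP => f.
rewrite memv_cap memv_ker lfunE memv0 => /andP[_ /eqP/(congr1 val)/eqP].
by rewrite mulf_eq0 (negbTE g0) => /eqP f0; apply/eqP/val_inj.
Qed.

Section Jets.
Variables (N c : nat) (D : 'I_c -> {linear {mpoly k[3]} -> {mpoly k[3]}}).
Variables (X : 'I_N -> vec3 k) (d : nat).

(** The operators [D] are a parameter so that the same map records values, gradients, or both. *)
Definition evmx (f : dhomog 3 k d) : 'M[k]_(N, c) := \matrix_(i, j) (D j (val f)).@[X i].

Lemma evmx_linear : linear evmx.
Proof.
move=> a f g; apply/matrixP => i j; rewrite !mxE /=.
by rewrite linearP mevalD mevalZ.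
Qed.

HB.instance Definition _ := GRing.isLinear.Build k _ _ _ evmx evmx_linear.

Definition evhom := linfun evmx.

Lemma evhomP (f : dhomog 3 k d) :
  reflect (forall i j, (D j (val f)).@[X i] = 0) (f \in lker evhom).
Proof.
rewrite memv_ker lfunE; apply: (iffP eqP) => [/matrixP h i j|h].
  by have := h i j; rewrite !mxE.
by apply/matrixP => i j; rewrite !mxE h.
Qed.

End Jets.

Definition jet0 (i : 'I_1) : {linear {mpoly k[3]} -> {mpoly k[3]}} := idfun.
Definition jet1 (i : 'I_3) : {linear {mpoly k[3]} -> {mpoly k[3]}} := mderiv i.
Definition jet01 (i : 'I_4) : {linear {mpoly k[3]} -> {mpoly k[3]}} :=
  oapp jet1 idfun (unlift ord0 i).

Definition sing_forms N (X : 'I_N -> vec3 k) d := lker (evhom jet01 X d).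

Lemma sing_formsP N (X : 'I_N -> vec3 k) d (f : dhomog 3 k d) :
  reflect (forall i, sing (X i) f) (f \in sing_forms X d).
Proof.
apply: (iffP (evhomP _ _ _)) => h i.
  split; first by have := h i ord0; rewrite /jet01 unlift_none.
  by move=> j; have := h i (lift ord0 j); rewrite /jet01 liftK.
move=> j; rewrite /jet01; case: unliftP => [j' _|_] /=; case: (h i) => // _; apply.
Qed.

(** In positive degree Euler's formula recovers the value from the gradient, so a double point costs
    three conditions instead of four. *)
Lemma sing_forms_grad N (X : 'I_N -> vec3 k) d :
  sing_forms X d.+1 = lker (evhom jet1 X d.+1).
Proof.
apply/vspaceP => f; apply/sing_formsP/evhomP => [h i j|h i]; first by case: (h i) => _; apply.
split=> [|j]; last exact: h.
have := euler_meval (X i) (valP f); rewrite big1 => [/esym/eqP|j _]; last first.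
  by rewrite (h i j) mulr0.
by rewrite mulf_eq0 (natk_eq0 char0) /= => /eqP.
Qed.

Definition no_form N (X : 'I_N -> vec3 k) e :=
  forall f, f \is e.-homog -> (forall i, f.@[X i] = 0) -> f = 0.

Lemma no_form_le N (X : 'I_N -> vec3 k) e e' : (e' <= e)%N -> no_form X e -> no_form X e'.
Proof.
move=> le h f hf fX; pose m := lin (mkvec 1 0 0 : vec3 k).
have m0 : m != 0 by apply: lin_neq0; exists ord0; rewrite ffunE oner_eq0.
have hm : m ^+ (e - e') \is (e - e').-homog.
  by have := dhomogMn (e - e') (lin_homog (mkvec 1 0 0 : vec3 k)); rewrite mul1n.
have := h (m ^+ (e - e') * f); rewrite -{2}(subnK le) => /(_ (dhomogM hm hf)).
move=> /(_ _)/eqP; rewrite mulf_eq0 expf_eq0 (negbTE m0) andbF /= => H; apply/eqP/H => i.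
by rewrite mevalM fX mulr0.
Qed.

Lemma sing_forms_eq0 N (X : 'I_N -> vec3 k) e d : no_form X e -> (d <= e.+1)%N ->
  \dim (sing_forms X d) = 0%N.
Proof.
move=> h le; apply/eqP; rewrite dimv_eq0 -subv0; apply/subvP => f /sing_formsP fX.
rewrite memv0; apply/eqP/val_inj => /=; case: d le f fX => [|d] le f fX.
  by apply: (no_form_le (leq0n e) h (valP f)) => i; case: (fX i).
apply/eqP; have /eqP := euler_homog (valP f); rewrite big1 => [/eqP/esym/eqP|i _].
  by rewrite scaler_eq0 (natk_eq0 char0).
rewrite (no_form_le (le : (d <= e)%N) h (dhomog_mderiv i (valP f))) ?mulr0 //= => j.
by case: (fX j) => _; apply.
Qed.

Lemma hilb_fat N (X : 'I_N -> vec3 k) (S : vec3 k -> Prop) d :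
  (forall f, f \is d.-homog -> (forall p, nonzero3 p -> S p -> sing p f) <->
     (forall i, sing (X i) f)) ->
  (hilb (fat_ideal S) d + \dim (sing_forms X d) = 'C(d.+2, 2))%N.
Proof.
move=> h; rewrite (@hilb_limg _ _ _ _ (evhom jet01 X d)) => [|f].
  by rewrite addnC -[sing_forms _ _]capfv limg_ker_dim dim_homog.
rewrite (fat_idealP char0 k_inf S (valP f)) h; last exact: valP.
split; first by move/sing_formsP; rewrite memv_ker => /eqP.
by move/eqP; rewrite -memv_ker => /sing_formsP.
Qed.

Lemma rank_le N (X : 'I_N -> vec3 k) d : (0 < d)%N ->
  ('C(d.+2, 2) <= \dim (sing_forms X d) + 3 * N)%N.
Proof.
case: d => // d _; rewrite sing_forms_grad -(dim_homog k) -(limg_ker_dim (evhom jet1 X d.+1) fullv).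
rewrite capfv leq_add2l; apply: leq_trans (dimvS (subvf _)) _.
by rewrite dimvf /dim /= mulnC.
Qed.

Definition interpolant N (X : 'I_N -> vec3 k) e (i : 'I_N) g :=
  g \is e.-homog /\ forall j, g.@[X j] = (j == i)%:R.

(** Evaluation at the points is injective on forms of degree [e], and source and target have the
    same dimension, so it is onto. *)
Lemma interpolantP N (X : 'I_N -> vec3 k) e i : N = 'C(e.+2, 2) -> no_form X e ->
  exists g, interpolant X e i g.
Proof.
move=> eN hX; pose phi := evhom jet0 X e.
have k0 : (fullv :&: lker phi = 0)%VS.
  apply/eqP; rewrite -subv0; apply/subvP => f; rewrite memv_cap memv0.
  case/andP=> _ /evhomP h; apply/eqP/val_inj => /=.
  by apply: hX (valP f) _ => j; apply: (h j ord0).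
have full : limg phi = fullv.
  apply/eqP; rewrite eqEdim subvf limg_dim_eq // dim_homog dimvf /dim /= muln1 -eN.
  exact: leqnn.
have : \matrix_(j, _) (j == i)%:R \in limg phi by rewrite full memvf.
case/memv_imgP => f _; rewrite lfunE => /matrixP h; exists (val f); split=> [|j].
  exact: valP.
by have := h j ord0; rewrite !mxE.
Qed.

(* With [g] an interpolant at P, [g^2 l] is singular at the other points, and by
   Euler's formula its gradient at P runs over all of k^3 when [l] runs over the
   linear forms. *)
Lemma grad_full N (X : 'I_N -> vec3 k) e : (forall i, exists g, interpolant X e i g) ->
  limg (evhom jet1 X (e + e).+1) = fullv.
Proof.
move=> hg; apply/vspaceP => M; rewrite memvf.
suff H i (w : 'rV[k]_3) : delta_mx i ord0 *m w \in limg (evhom jet1 X (e + e).+1).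
  rewrite [M](_ : _ = \sum_i delta_mx i ord0 *m row i M); first by apply: rpred_sum.
  apply/matrixP => i j; rewrite summxE (bigD1 i) //= big1 => [|i' ii'].
    by rewrite addr0 !mxE big_ord1 !mxE !eqxx mul1r.
  by rewrite !mxE big_ord1 !mxE [i == _]eq_sym (negbTE ii') mul0r.
have [g [gh gX]] := hg i.
(* The gradient of g^2 l at the point is 2 l(X_i) grad g + l, which must be [w]. Pairing with X_i
   and using Euler for [g] gives (2e+1) l(X_i) = w.X_i, which determines [a] = l(X_i), then [l]. *)
pose a := (\sum_j w ord0 j * X i j) / (e + e).+1%:R.
pose l : vec3 k := [ffun j => w ord0 j - 2%:R * a * g^`M(j).@[X i]].
have hf : g * g * lin l \is ((e + e).+1).-homog.
  by rewrite -[(e + e).+1]addn1; apply: dhomogM (dhomogM gh gh) (lin_homog l).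
have la : dot l (X i) = a.
  have lX j : l j * X i j = w ord0 j * X i j - 2%:R * a * (X i j * g^`M(j).@[X i]).
    by rewrite ffunE; ring.
  rewrite /dot (eq_bigr _ (fun j _ => lX j)).
  rewrite sumrB -mulr_sumr (euler_meval _ gh) gX eqxx mulr1.
  have -> : \sum_j w ord0 j * X i j = a * (e + e).+1%:R.
    by rewrite divfK // (natk_eq0 char0).
  by rewrite -[in X in a * X]addn1 !natrD; ring.
apply/memv_imgP; exists (DHomog hf); first exact: memvf.
rewrite lfunE; apply/matrixP => i' j; rewrite !mxE big_ord1 !mxE /= andbT.
rewrite !mderivM mderiv_lin !mevalD !mevalM lin_meval mevalD !mevalM mevalC gX.
have [->|_] := eqVneq i' i; last by rewrite !mulr0n; ring.
by rewrite !mulr1n la ffunE; ring.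
Qed.

Lemma dim_sing_forms_regularity N (X : 'I_N -> vec3 k) e : N = 'C(e.+2, 2) -> no_form X e ->
  \dim (sing_forms X (e + e).+1) = 'C(e.+1, 2).
Proof.
move=> eN hX; have /grad_full full := fun i => interpolantP i eN hX.
have := limg_ker_dim (evhom jet1 X (e + e).+1) fullv.
rewrite capfv -sing_forms_grad full dim_homog dimvf /dim /=.
by have := bin2_regularity e; move: eN; lia.
Qed.

(** * Restricting the singular systems to a general line *)

Section Restriction.
Variables (N : nat) (X : 'I_N -> vec3 k).

Lemma sing_mul_lin l p f : dot l p != 0 -> sing p (lin l * f) <-> sing p f.
Proof.
move=> lp; split=> [[]|[h1 h2]].
  rewrite mevalM lin_meval => /eqP; rewrite mulf_eq0 (negbTE lp) /= => /eqP fp h2.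
  split=> // i; have /eqP := h2 i.
  by rewrite mderivM mevalD !mevalM lin_meval fp mulr0 add0r mulf_eq0 (negbTE lp) => /eqP.
split=> [|i]; first by rewrite mevalM h1 mulr0.
by rewrite mderivM mevalD !mevalM h1 h2 !mulr0 addr0.
Qed.

Variable s : k.
Hypothesis sX : forall i, dot (mkvec 1 s (s ^+ 2)) (X i) != 0.

Let l := mkvec 1 s (s ^+ 2).
(** A basis of the line [l] for which x_1 restricts to 1 and x_2 to the coordinate ['X]. *)
Let A := mkvec (- s) 1 0.
Let B := mkvec (- s ^+ 2) 0 1.

(** The length [M] is independent of the degree so that restrictions from consecutive degrees live
    in one space; nothing is truncated when d < M. *)
Definition restr_row M d (f : dhomog 3 k d) : 'rV[k]_M := poly_rV (restr A B (val f)).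

Lemma restr_row_linear M d : linear (@restr_row M d).
Proof. by move=> a f g; rewrite /restr_row /= rmorphD /= restrZ linearP. Qed.

HB.instance Definition _ M d := GRing.isLinear.Build k _ _ _ (@restr_row M d)
  (@restr_row_linear M d).

Definition restr_system M d := (linfun (@restr_row M d) @: sing_forms X d)%VS.

Lemma rVpoly_restr M d (f : dhomog 3 k d) : (d < M)%N ->
  rVpoly (linfun (@restr_row M d) f) = restr A B (val f).
Proof.
move=> dM; rewrite lfunE /= poly_rV_K //; apply: leq_trans (size_restr _ _ (valP f)) dM.
Qed.

Lemma restr_lin_eq0 : restr A B (lin l) = 0.
Proof.
rewrite rmorph_sum /= !big_ord_recl big_ord0 !restrZ !restrX !ffunE /=.
rewrite -!mul_polyC; ring.
Qed.

Lemma restr_eq0_mdvd d f : f \is d.-homog -> restr A B f = 0 -> mdvd (lin l) f.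
Proof.
apply: (@restr_line_eq0 _ char0 k_inf l (mkvec 0 1 0)).
- by exists ord0; rewrite ffunE oner_eq0.
- by rewrite dotE !ffunE /=; ring.
- by rewrite dotE !ffunE /= !(mul0r, mulr0, mul1r, add0r, addr0) oner_eq0.
move=> v; rewrite dotE !ffunE /= => lv; exists (v (lift ord0 (lift ord0 ord0))).
apply: ord3P; rewrite !dotE !ffunE /=; [|by ring|by ring].
by rewrite -[LHS]subr0 -{1}lv; ring.
Qed.

(** The kernel of restriction consists of multiples of [lin l], and the cofactor is still singular
    at the points because [l] misses them. *)
Lemma dim_sing_step M d : (d.+1 < M)%N ->
  \dim (sing_forms X d.+1) = (\dim (sing_forms X d) + \dim (restr_system M d.+1))%N.
Proof.
rewrite -add1n => dM.
rewrite -(limg_ker_dim (linfun (@restr_row M (1 + d))) (sing_forms X (1 + d))).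
congr (_ + _)%N; have l0 : lin l != 0.
  by apply: lin_neq0; exists ord0; rewrite ffunE oner_eq0.
rewrite -(dim_mulhom (lin_homog l) (sing_forms X d) l0).
congr (\dim _); apply/vspaceP => f; rewrite memv_cap memv_ker.
apply/andP/memv_imgP => [[/sing_formsP fX /eqP f0]|[g /sing_formsP gX ->]].
  have [w ew] : mdvd (lin l) (val f).
    apply: (restr_eq0_mdvd (valP f)).
    by rewrite -(rVpoly_restr f dM) f0 linear0.
  have {}ew := dhomog_quotient (e := d) (lin_homog l) (valP f) ew.
  exists (DHomog (pihomogP mdeg d w)); last by rewrite lfunE; apply: val_inj.
  by apply/sing_formsP => i /=; apply/(sing_mul_lin _ (sX i)); rewrite -ew; apply: fX.
rewrite lfunE /=; split.
  by apply/sing_formsP => i /=; apply/(sing_mul_lin _ (sX i)); apply: gX.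
by rewrite lfunE /= /restr_row rmorphM /= restr_lin_eq0 mul0r linear0.
Qed.

Lemma restr_X1 : restr A B 'X_(lift ord0 ord0) = 1.
Proof. by rewrite restrX !ffunE /= scale0r addr0. Qed.

Lemma restr_X2 : restr A B 'X_(lift ord0 (lift ord0 ord0)) = 'X.
Proof. by rewrite restrX !ffunE /= scale1r add0r. Qed.

Lemma sing_mul_X d (f : dhomog 3 k d) i (hX : 'X_i * val f \is (d.+1).-homog) :
  f \in sing_forms X d -> DHomog hX \in sing_forms X d.+1.
Proof.
move/sing_formsP => fX; apply/sing_formsP => j /=; have [h1 h2] := fX j.
split=> [|r]; first by rewrite mevalM h1 mulr0.
by rewrite mderivM mevalD !mevalM h1 h2 !mulr0 addr0.
Qed.

(* If the restrictions to the line did not grow, they would be stable under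
   multiplication by the coordinate, although their degrees are bounded. *)
Lemma restr_system_grows M d : (d.+1 < M)%N -> (0 < \dim (restr_system M d))%N ->
  (\dim (restr_system M d) < \dim (restr_system M d.+1))%N.
Proof.
move=> dM J0; have dM' : (d < M)%N by apply: ltnW.
have hX i (f : dhomog 3 k d) : 'X_i * val f \is (d.+1).-homog.
  apply: (@dhomogM _ _ _ 1 _ d) => //; last exact: valP.
  by rewrite dhomogX; apply/eqP; exact: mdeg1.
(* Multiplication by x_1 does not change the restriction. *)
have sub : (restr_system M d <= restr_system M d.+1)%VS.
  apply/subvP => _ /memv_imgP[f fZ ->]; apply/memv_imgP.
  exists (DHomog (hX (lift ord0 ord0) f)); first exact: sing_mul_X.
  by rewrite !lfunE /= /restr_row /= rmorphM /= restr_X1 mul1r.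
rewrite ltn_neqAle dimvS // andbT; apply/negP => /eqP edim.
have eqJ : restr_system M d = restr_system M d.+1.
  by apply/eqP; rewrite eqEdim sub edim leqnn.
have grow n : exists f : dhomog 3 k d, [/\ f \in sing_forms X d,
    restr A B (val f) != 0 & (n <= size (restr A B (val f)))%N].
  elim: n => [|n [f [fZ f0 sz]]].
    have : restr_system M d != 0%VS by rewrite -dimv_eq0 -lt0n.
    rewrite -subv0 => /subvPn[_ /memv_imgP[f fZ ->]]; rewrite memv0 => h; exists f; split=> //.
    by apply: contraNneq h => h; rewrite lfunE /= /restr_row h linear0.
  have : linfun (@restr_row M d.+1) (DHomog (hX (lift ord0 (lift ord0 ord0)) f)) \in restr_system M d.
    by rewrite eqJ; apply/memv_img/sing_mul_X.
  case/memv_imgP => g gZ /(congr1 (@rVpoly _ _)); rewrite !rVpoly_restr //= rmorphM /= restr_X2.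
  move=> eg; exists g; split=> //; rewrite -eg ?mulf_neq0 ?polyX_eq0 //.
  by rewrite mulrC size_mulX.
have [f [_ _]] := grow d.+2; apply/negP; rewrite -ltnNge.
exact: size_restr (valP f).
Qed.

Lemma dim_restr_system_le d : (\dim (restr_system d.+1 d) <= d.+1)%N.
Proof. by apply: leq_trans (dimvS (subvf _)) _; rewrite dimvf /dim /= mul1n. Qed.

End Restriction.

Lemma moment_line_family N (X : 'I_N -> vec3 k) : (forall i, nonzero3 (X i)) ->
  exists s, forall i, dot (mkvec 1 s (s ^+ 2)) (X i) != 0.
Proof.
move=> nX; have [|s hs] := @moment_line _ k_inf (codom X).
  by move=> _ /codomP[i ->].
by exists s => i; apply/hs/codom_f.
Qed.

(** The upper bound d+2 is also the growth of the space of all forms, so the Hilbert function of the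
    double points never decreases. *)
Lemma dim_sing_mono N (X : 'I_N -> vec3 k) d : (forall i, nonzero3 (X i)) ->
  (\dim (sing_forms X d) <= \dim (sing_forms X d.+1) <= \dim (sing_forms X d) + d.+2)%N.
Proof.
move=> /moment_line_family[s hs].
rewrite (dim_sing_step hs (ltnSn d.+1)) leq_addr leq_add2l /=.
exact: dim_restr_system_le.
Qed.

Lemma dim_sing_convex N (X : 'I_N -> vec3 k) d : (forall i, nonzero3 (X i)) ->
  (\dim (sing_forms X d) < \dim (sing_forms X d.+1))%N ->
  (2 * \dim (sing_forms X d.+1) < \dim (sing_forms X d.+2) + \dim (sing_forms X d))%N.
Proof.
move=> /moment_line_family[s hs].
have := @restr_system_grows _ X s d.+3 d.+1 (ltnSn _).
rewrite (dim_sing_step hs (ltnSn d.+2)) (dim_sing_step hs (ltnW (ltnSn d.+2))); lia.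
Qed.

(** The extremal sequence has steps 1, 2, 3, and so on. Once [a] exceeds it at m, the step into m
    exceeds m; by convexity all later steps are too large as well, and [a] stays above up to [e], a
    contradiction. *)
Lemma convex_bound (a : nat -> nat) e : a 0%N = 0%N -> a e = 'C(e.+1, 2) ->
  (forall n, (a n < a n.+1)%N -> (2 * a n.+1 < a n.+2 + a n)%N) ->
  forall n, (n <= e)%N -> (a n <= 'C(n.+1, 2))%N.
Proof.
move=> a0 ae cvx n ne; rewrite leqNgt; apply/negP.
have key m : ('C(m.+1, 2) < a m)%N -> (0 < m)%N /\ (a m.-1 + m < a m)%N.
  elim: m => [|m IH]; rewrite ?a0 // => h; split=> //=.
  move: h; rewrite binS2; case: (leqP (a m) 'C(m.+1, 2)) => [|/IH[]]; first lia.
  by case: m {IH} => // m _ /= h1 h2; have := cvx m; lia.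
have step m : ('C(m.+1, 2) < a m)%N -> ('C(m.+2, 2) < a m.+1)%N.
  move=> h; have [] := key m h; case: m h => // m h _ /= h1.
  by have := cvx m; rewrite binS2; lia.
move=> h; have : forall r, ('C((n + r).+1, 2) < a (n + r))%N.
  by elim=> [|r IH]; rewrite ?addn0 // addnS; apply: step.
by move=> /(_ (e - n)%N); rewrite subnKC // ae ltnn.
Qed.

Lemma dim_sing_forms_le N (X : 'I_N -> vec3 k) e d : N = 'C(e.+2, 2) ->
  (forall i, nonzero3 (X i)) -> no_form X e -> (d <= (e + e).+1)%N ->
  (\dim (sing_forms X d) <= 'C(d - e, 2))%N.
Proof.
move=> eN nX hX le; have [dle|dgt] := leqP d e.+1.
  by rewrite (sing_forms_eq0 hX dle).
have := @convex_bound (fun n => \dim (sing_forms X (e.+1 + n))) e _ _ _ (d - e.+1) _.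
rewrite subnKC ?(ltnW dgt) // subnS prednK ?subn_gt0; last by apply: ltn_trans dgt.
apply.
- by rewrite addn0 (sing_forms_eq0 hX).
- by rewrite addSn (dim_sing_forms_regularity eN hX).
- by move=> n; rewrite !addnS; apply: dim_sing_convex.
- by lia.
Qed.

End Systems.

(** * Star configurations *)

Section Star.
Variable k : fieldType.
Implicit Types (p q v l : vec3 k) (f g h : {mpoly k[3]}).

Hypothesis char0 : [pchar k] =i pred0.
Hypothesis k_inf : forall N : nat, exists s : seq k, uniq s /\ size s = N.

Lemma sing_mulr p f g : sing p f -> sing p (f * g).
Proof.
move=> [h1 h2]; split=> [|i]; first by rewrite mevalM h1 mul0r.
by rewrite mderivM mevalD !mevalM h1 h2 !mul0r addr0.
Qed.

Lemma sing_mul p f g : f.@[p] = 0 -> g.@[p] = 0 -> sing p (f * g).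
Proof.
move=> h1 h2; split=> [|i]; first by rewrite mevalM h1 mul0r.
by rewrite mderivM mevalD !mevalM h1 h2 mul0r mulr0 addr0.
Qed.

Lemma mdvd_homog_le d e f g : f \is d.-homog -> g \is e.-homog -> g != 0 ->
  mdvd f g -> (d <= e)%N.
Proof.
move=> hf hg g0 [w eg]; have : f * w != 0 by rewrite -eg.
rewrite mulf_eq0 negb_or => /andP[f0 w0].
have := dhomog_msizeE hg g0; rewrite eg msizeM // (dhomog_msizeE hf f0).
by rewrite (mpolySpred _ w0) addSn addnS /=; lia.
Qed.

Lemma prod_lin_homog (I : Type) (r : seq I) (L : I -> vec3 k) :
  \prod_(i <- r) lin (L i) \is (size r).-homog.
Proof.
elim: r => [|i r IH]; first by rewrite big_nil dhomog1.
by rewrite big_cons; apply: (dhomogM (lin_homog (L i)) IH).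
Qed.

Lemma prod_lin_neq0 (I : eqType) (r : seq I) (L : I -> vec3 k) :
  (forall i, i \in r -> nonzero3 (L i)) -> \prod_(i <- r) lin (L i) != 0.
Proof.
by move=> h; rewrite prodf_seq_neq0; apply/allP => i ir; apply/lin_neq0/h.
Qed.

Lemma meval_prod_lin (I : eqType) (r : seq I) (L : I -> vec3 k) p :
  reflect (exists2 i, i \in r & dot (L i) p = 0)
    ((\prod_(i <- r) lin (L i)).@[p] == 0).
Proof.
rewrite rmorph_prod prodf_seq_eq0 /=.
apply: (iffP hasP) => -[i ir]; first by rewrite lin_meval => /eqP; exists i.
by move=> h; exists i; rewrite // lin_meval h.
Qed.

Lemma prod_lin_mdvd (I : eqType) (r : seq I) (L : I -> vec3 k) f : uniq r ->
  (forall i, i \in r -> nonzero3 (L i)) ->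
  (forall i j, i \in r -> j \in r -> i != j -> ~ proportional (L i) (L j)) ->
  (forall i, i \in r -> mdvd (lin (L i)) f) -> mdvd (\prod_(i <- r) lin (L i)) f.
Proof.
elim: r => [|i r IH] /=; first by move=> *; exists f; rewrite big_nil mul1r.
move=> /andP[ir ur] nL pL df.
have sub j : j \in r -> j \in i :: r by rewrite in_cons orbC => ->.
have [|||w ew] := IH ur.
- by move=> j /sub; apply: nL.
- by move=> j j' /sub hj /sub; apply: pL.
- by move=> j /sub; apply: df.
have ni := nL i (mem_head _ _).
have := df i (mem_head _ _); rewrite ew => /(lin_prime ni)[|[u eu]]; last first.
  by exists u; rewrite big_cons [lin _ * _]mulrC -mulrA -eu.
move/(mdvd_lin_prod ni) => [j jr h]; exfalso.
apply: (pL i j (mem_head _ _) (sub j jr)); last by apply: mdvd_linP h _ _ => //; apply/nL/sub.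
by apply: contraNneq ir => ->.
Qed.

Lemma card_lt_pairs t : #|[set x : 'I_t * 'I_t | (x.1 < x.2)%N]| = 'C(t, 2).
Proof.
rewrite -sum1_card -bin2_sum big_mkord.
rewrite (eq_bigl (fun x : 'I_t * 'I_t => (x.1 < x.2)%N)); last by move=> x; rewrite inE.
rewrite -(pair_big_dep xpredT (fun i j : 'I_t => (i < j)%N) (fun _ _ => 1%N)) /=.
rewrite (exchange_big_dep xpredT) //=; apply: eq_bigr => j _.
by rewrite -[RHS]card_ord -[RHS]sum1_card (big_ord_widen t (fun=> 1%N) (ltnW (ltn_ord j))).
Qed.

Variables (e : nat) (L : 'I_e.+2 -> vec3 k).
Hypothesis hL : good_lines L.

Let nL i : nonzero3 (L i). Proof. by case: hL. Qed.
Let pL i j : i != j -> ~ proportional (L i) (L j).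
Proof. by case: hL => _ [h _]; apply: h. Qed.

Definition star_pairs := [set x : 'I_e.+2 * 'I_e.+2 | (x.1 < x.2)%N].
Definition star_point (i : 'I_#|star_pairs|) : vec3 k :=
  cross (L (enum_val i).1) (L (enum_val i).2).
Definition star_poly := \prod_(i <- enum 'I_e.+2) lin (L i).

Let ncross i j : i != j -> nonzero3 (cross (L i) (L j)).
Proof. by move=> ij; apply: cross_neq0 (nL i) (nL j) (pL ij). Qed.

Lemma star_point_lt (i : 'I_#|star_pairs|) : ((enum_val i).1 < (enum_val i).2)%N.
Proof. by have := enum_valP i; rewrite inE. Qed.

Lemma star_point_neq0 i : nonzero3 (star_point i).
Proof. by apply: ncross; have := star_point_lt i; case: eqP => // ->; rewrite ltnn. Qed.

Lemma star_point_prop i j p : i != j -> nonzero3 p -> dot (L i) p = 0 -> dot (L j) p = 0 ->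
  exists r, proportional (star_point r) p.
Proof.
wlog lt : i j / (i < j)%N => [W|] ij np ip jp.
  have [lt|gt|/val_inj eq] := ltngtP i j; first exact: (W i j).
    by apply: (W j i) => //; rewrite eq_sym.
  by rewrite eq eqxx in ij.
have mem : (i, j) \in star_pairs by rewrite inE.
exists (enum_rank_in mem (i, j)); rewrite /star_point enum_rankK_in //=.
apply: on_two_lines (ncross ij) (ncross ij) np _ _ ip jp.
  exact: dot_crossl.
exact: dot_crossr.
Qed.

(** The other e+1 lines meet [L i] in distinct points because no three lines are concurrent. *)
Lemma star_line_points i :
  let P := [seq cross (L i) (L j) | j <- enum 'I_e.+2 & j != i] in
  [/\ point_list P, forall p, p \in P -> dot (L i) p = 0 & size P = e.+1].
Proof.
move=> P; have memP j : (j \in [seq j <- enum 'I_e.+2 | j != i]) = (j != i).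
  by rewrite mem_filter mem_enum andbT.
have sP : size P = e.+1.
  rewrite size_map -sum1_size big_filter big_enum_cond sum1_card.
  by have := cardC1 i; rewrite card_ord.
split=> //; last by move=> p /mapP[j _ ->]; apply: dot_crossl.
split=> [p /mapP[j]|a b la lb ab].
  by rewrite memP => ji ->; apply: ncross; rewrite eq_sym.
rewrite size_map in la lb; rewrite !(nth_map i) //.
set x := nth i _ a; set y := nth i _ b; move=> h.
have xi : x != i by rewrite -memP mem_nth.
have yi : y != i by rewrite -memP mem_nth.
have xy : x != y by rewrite nth_uniq // filter_uniq ?enum_uniq.
case: hL => _ [_ /(_ i x y (cross (L i) (L y)))]; apply=> //.
- by rewrite eq_sym.
- by rewrite eq_sym.
- by apply: ncross; rewrite eq_sym.
- split; [exact: dot_crossl | exact: dot_proportional h (dot_crossr _ _) | exact: dot_crossr].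
Qed.

Lemma star_lines_dvd (b : bool) d f : f \is d.-homog ->
  (forall i, if b then sing (star_point i) f else f.@[star_point i] = 0) ->
  (d < b.+1 * e.+1)%N -> mdvd star_poly f.
Proof.
move=> hf fX lt; apply: prod_lin_mdvd; rewrite ?enum_uniq //.
  by move=> i j _ _; apply: pL.
move=> i _; have [Pl Pi Ps] := star_line_points i.
apply: (line_dvd char0 k_inf (b := b) (nL i) Pl Pi hf _ _); last by rewrite Ps.
move=> p /mapP[j]; rewrite mem_filter => /andP[ji _] {p}->.
have [||||r hr] := @star_point_prop i j (cross (L i) (L j)); rewrite 1?eq_sym //.
- by apply: ncross; rewrite eq_sym.
- exact: dot_crossl.
- exact: dot_crossr.
have := fX r; case: (b); first exact: sing_scale hf hr.
move=> f0; case: hr => c [_ hc]; rewrite (meval_eq _ hc).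
by rewrite (dhomog_meval_scale _ _ hf) f0 mulr0.
Qed.

Lemma star_poly_homog : star_poly \is (e.+2).-homog.
Proof. by have := prod_lin_homog (enum 'I_e.+2) L; rewrite size_enum_ord. Qed.

Lemma star_poly_neq0 : star_poly != 0.
Proof. exact: prod_lin_neq0. Qed.

Lemma star_poly_sing r : sing (star_point r) star_poly.
Proof.
rewrite /star_poly /star_point; set i := (_ r).1; set j := (enum_val r).2.
have ij : i != j by have := star_point_lt r; rewrite -/i -/j; case: eqP => // ->; rewrite ltnn.
rewrite (bigD1_seq i (mem_enum _ i) (enum_uniq _)) /= -big_filter.
have mj : j \in [seq j <- enum 'I_e.+2 | j != i] by rewrite mem_filter mem_enum andbT eq_sym.
have uf : uniq [seq j <- enum 'I_e.+2 | j != i] by rewrite filter_uniq ?enum_uniq.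
rewrite (bigD1_seq j mj uf) /=.
rewrite mulrA; apply/sing_mulr/sing_mul; rewrite lin_meval.
  exact: dot_crossl.
exact: dot_crossr.
Qed.

Lemma star_no_form : no_form star_point e.
Proof.
move=> f hf fX; have [//|f0] := eqVneq f 0.
have /(mdvd_homog_le star_poly_homog hf f0) : mdvd star_poly f; last by lia.
by apply: (@star_lines_dvd false) hf _ _ => //; rewrite mul1n.
Qed.

(** Since d < 2(e+1), Bezout makes each line a component. So the system is [star_poly] times all
    forms of degree d-e-2, or zero when d is at most e+1. *)
Lemma dim_sing_star d : (d <= (e + e).+1)%N -> \dim (sing_forms star_point d) = 'C(d - e, 2).
Proof.
move=> le; have [dle|dgt] := leqP d e.+1.
  rewrite (sing_forms_eq0 char0 star_no_form dle).
  by rewrite bin_small //; lia.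
have [d' ed] : exists d', d = (e.+2 + d')%N by exists (d - e.+2)%N; rewrite subnKC.
rewrite {}ed in le *; have -> : (e.+2 + d' - e = d'.+2)%N by lia.
rewrite -(dim_homog k) -(dim_mulhom star_poly_homog fullv star_poly_neq0).
congr (\dim _); apply/vspaceP => f; apply/sing_formsP/memv_imgP => [fX|[g _ ->] i]; last first.
  by rewrite lfunE; apply/sing_mulr/star_poly_sing.
have [w ew] : mdvd star_poly (val f).
  by apply: (@star_lines_dvd true) (valP f) _ _ => //; lia.
have {}ew := dhomog_quotient star_poly_homog (valP f) ew.
exists (DHomog (pihomogP mdeg d' w)); rewrite ?memvf // lfunE; exact: val_inj.
Qed.

Lemma star_fat d f : f \is d.-homog ->
  (forall p, nonzero3 p -> inter_pts L p -> sing p f) <-> (forall i, sing (star_point i) f).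
Proof.
move=> hf; split=> [h i|h p np [i [j [ij [ip jp]]]]].
  apply: h; first exact: star_point_neq0.
  exists (enum_val i).1, (enum_val i).2; split.
    by have := star_point_lt i; case: eqP => // ->; rewrite ltnn.
  by split; [exact: dot_crossl | exact: dot_crossr].
have [r hr] := star_point_prop ij np ip jp.
exact: sing_scale hf hr (h r).
Qed.

Lemma hilb_star_low d : (d <= (e + e).+1)%N ->
  (hilb (fat_ideal (inter_pts L)) d + 'C(d - e, 2) = 'C(d.+2, 2))%N.
Proof.
move=> le; rewrite -(dim_sing_star le); apply: (hilb_fat char0 k_inf).
by move=> f; apply: star_fat.
Qed.

(** Three conditions per point bound the value from above; it is attained in degree 2e+1, and the
    Hilbert function does not decrease. *)
Lemma hilb_star_high d : ((e + e).+1 <= d)%N ->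
  hilb (fat_ideal (inter_pts L)) d = (3 * 'C(e.+2, 2))%N.
Proof.
move=> le; have hz d' : (hilb (fat_ideal (inter_pts L)) d' +
    \dim (sing_forms star_point d') = 'C(d'.+2, 2))%N.
  by apply: (hilb_fat char0 k_inf) => f; apply: star_fat.
have up : (hilb (fat_ideal (inter_pts L)) d <= 3 * 'C(e.+2, 2))%N.
  have d0 : (0 < d)%N by apply: leq_trans le.
  suff : ('C(d.+2, 2) <= \dim (sing_forms star_point d) + 3 * 'C(e.+2, 2))%N.
    by have := hz d; lia.
  by rewrite -[in X in (_ + X)%N]card_lt_pairs; apply: rank_le.
apply/eqP; rewrite eqn_leq up /=; elim: d le {up} => // d IH.
rewrite leq_eqVlt => /predU1P[<-|le].
  have := hz (e + e).+1; rewrite (dim_sing_forms_regularity char0 (card_lt_pairs _) star_no_form).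
  by have := bin2_regularity e; lia.
have := IH le; have := hz d; have := hz d.+1; rewrite binS2.
by have /andP[] := dim_sing_mono char0 k_inf d star_point_neq0; lia.
Qed.

End Star.

(** * Curves of degree t singular at binom(t, 2) points *)

Section Splitting.
Variable k : fieldType.
Implicit Types (p q v l : vec3 k) (f g h u w : {mpoly k[3]}).

Hypothesis char0 : [pchar k] =i pred0.
Hypothesis k_inf : forall N : nat, exists s : seq k, uniq s /\ size s = N.

Lemma mdvd_lin_cancel l f g : nonzero3 l -> ~ mdvd (lin l) f ->
  mdvd f (lin l * g) -> mdvd f g.
Proof.
move=> nl lf [u eu].
have [//|[w ew]] : mdvd (lin l) f \/ mdvd (lin l) u.
  by apply: lin_prime => //; exists g.
exists w; apply: (mulfI (lin_neq0 nl)).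
by rewrite eu ew mulrCA.
Qed.

Lemma mdvd_lin_expr_cancel l n f g : nonzero3 l -> ~ mdvd (lin l) f ->
  mdvd f (lin l ^+ n * g) -> mdvd f g.
Proof.
move=> nl lf; elim: n => [|n IH]; first by rewrite expr0 mul1r.
by rewrite exprS -mulrA => /(mdvd_lin_cancel nl lf).
Qed.

(** Linear factors are split off one at a time, by induction on the degree; [s] lists them with
    multiplicity. *)
Lemma linear_factors n f : f \is n.-homog -> f != 0 ->
  exists (s : seq (vec3 k)) g, [/\ forall l, l \in s -> nonzero3 l,
    f = \prod_(l <- s) lin l * g, (size s <= n)%N, g \is (n - size s).-homog &
    forall l, nonzero3 l -> ~ mdvd (lin l) g].
Proof.
elim: n f => [|n IH] f hf f0.
  exists [::], f; rewrite big_nil mul1r; split=> // l nl h.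
  by have := mdvd_homog_le (lin_homog l) hf f0 h.
case: (classic (exists l, nonzero3 l /\ mdvd (lin l) f)) => [[l [nl [w ew]]]|h].
  have {}ew := dhomog_quotient (e := n) (lin_homog l) hf ew.
  have := IH _ (pihomogP mdeg n w).
  move: ew; set w' := pihomog _ _ _ => ew; case=> [|s [g [ns es sn hg hl]]].
    by apply: contraNneq f0 => w0; rewrite ew w0 mulr0.
  exists (l :: s), g; split=> //=.
    by move=> l'; rewrite in_cons => /predU1P[->|/ns].
  by rewrite big_cons -mulrA -es.
exists [::], f; rewrite big_nil mul1r subn0; split=> // l nl hl.
by apply: h; exists l.
Qed.

(** * An extremal curve is a union of lines (here t = e + 3) *)

Section Core.
Variables (N e : nat) (X : 'I_N -> vec3 k).
Hypotheses (eN : N = 'C(e.+3, 2)) (hX : no_form X e.+1).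
Hypothesis nX : forall i, nonzero3 (X i).
Variable F : {mpoly k[3]}.
Hypotheses (hF : F \is (e.+3).-homog) (F0 : F != 0) (FX : forall i, sing (X i) F).

(* The forms of degree 2t-3 singular on X have the dimension of the forms of
   degree t-3, so they are the multiples of F. *)
Lemma sing_forms_multiple f : f \is ((e.+1 + e.+1).+1).-homog ->
  (forall i, sing (X i) f) -> mdvd F f.
Proof.
have -> : ((e.+1 + e.+1).+1 = e.+3 + e)%N by lia.
move=> hf fX; have /eqP : (linfun (mulhom hF) @: fullv)%VS = sing_forms X (e.+3 + e).
  apply/eqP; rewrite eqEdim dim_mulhom // dim_homog; apply/andP; split.
    apply/subvP => _ /memv_imgP[g _ ->]; apply/sing_formsP => i; rewrite lfunE.
    exact: sing_mulr.
  have -> : (e.+3 + e = (e.+1 + e.+1).+1)%N by lia.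
  by rewrite (dim_sing_forms_regularity char0 eN hX).
move/eqP/vspaceP/(_ (DHomog hf)); rewrite (introT (sing_formsP _ _)) //.
by move/memv_imgP => [g _ /(congr1 val)]; rewrite lfunE => /= ->; exists (val g).
Qed.

(* For interpolants g_i, g_j and the line l through X_i and X_j, the form
   l g_i g_j is singular on X, hence divisible by F.  If F were prime to all
   these lines, it would divide g_i h for every form h of degree t-2 vanishing
   at X_i, such as a power of a linear form prime to F. *)
Lemma linear_factor_through i : exists l, [/\ nonzero3 l, dot l (X i) = 0 & mdvd (lin l) F].
Proof.
apply: NNPP => no.
have [g hg] : exists g : 'I_N -> {mpoly k[3]}, forall j, interpolant X e.+1 j (g j).
  by apply: fin_all_exists => j; apply: interpolantP.
have hgi j := (hg j).1; have gX j := (hg j).2.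
have dvdF j : j != i -> mdvd F (g i * g j).
  move=> ji; pose l := cross (X i) (X j).
  have nl : nonzero3 l.
    apply: cross_neq0 => // -[c [c0 hc]]; have /eqP := gX i j.
    rewrite (negbTE ji) (meval_eq _ hc) (dhomog_meval_scale _ _ (hgi i)) gX eqxx mulr1.
    by rewrite expf_eq0 (negbTE c0).
  apply: (mdvd_lin_cancel nl).
    by move=> lF; apply: no; exists l; split=> //; rewrite dotC dot_crossl.
  have hf : lin l * (g i * g j) \is ((e.+1 + e.+1).+1).-homog.
    by apply: (dhomogM (lin_homog l)); apply: dhomogM.
  apply: sing_forms_multiple hf _ => r.
  have [->|ri] := eqVneq r i.
    rewrite mulrCA [g i * _]mulrC; apply/sing_mulr/sing_mul.
      by rewrite lin_meval dotC dot_crossl.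
    by rewrite gX eq_sym (negbTE ji).
  have [->|rj] := eqVneq r j.
    rewrite mulrA; apply/sing_mulr/sing_mul; first by rewrite lin_meval dotC dot_crossr.
    by rewrite gX (negbTE ji).
  by rewrite mulrC; apply/sing_mulr/sing_mul; rewrite gX ?(negbTE ri) ?(negbTE rj).
(* The line [m] through X_i and a point [Q] off the curve is not a component of [F]. *)
have [Q FQ] := meval_neq0 char0 k_inf F0.
pose m := cross (X i) Q.
have nQ : nonzero3 Q.
  apply: NNPP => h; case/negP: FQ; apply/eqP.
  rewrite (@meval_eq _ _ _ (fun j => 0 * X i j)) ?(dhomog_meval_scale _ _ hF); last first.
    move=> j; rewrite mul0r; apply/eqP/negPn/negP => Qj; by apply: h; exists j.
  by case: (FX i) => -> _; rewrite mulr0.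
have nm : nonzero3 m.
  apply: cross_neq0 => // -[c [_ hc]]; case/negP: FQ.
  by rewrite (meval_eq _ hc) (dhomog_meval_scale _ _ hF); case: (FX i) => -> _; rewrite mulr0.
have mF : ~ mdvd (lin m) F.
  move=> h; case/negP: FQ; apply/eqP; apply: mdvd_lin_meval h.
  by rewrite dotC dot_crossr.
have hm : lin m ^+ e.+1 \is (e.+1).-homog.
  by have := dhomogMn e.+1 (lin_homog m); rewrite mul1n.
(* The power has the degree of the interpolants, so it is determined by its values; the term at [i]
   vanishes because [m] passes through X_i. *)
have em : lin m ^+ e.+1 = \sum_j (lin m ^+ e.+1).@[X j] *: g j.
  apply/eqP; rewrite -subr_eq0; apply/eqP/hX => [|r].
    by rewrite rpredB // rpred_sum // => j _; apply: rpredZ (hgi j).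
  have sumE : (\sum_j (lin m ^+ e.+1).@[X j] *: g j).@[X r] =
      \sum_j (lin m ^+ e.+1).@[X j] * (g j).@[X r].
    by rewrite raddf_sum; apply: eq_bigr => j _; rewrite /= mevalZ.
  rewrite mevalB sumE (bigD1 r) //= gX eqxx mulr1 big1 ?addr0 ?subrr // => j jr.
  by rewrite gX eq_sym (negbTE jr) mulr0.
have : mdvd F (lin m ^+ e.+1 * g i).
  have /fin_all_exists[w hw] j : exists w, (lin m ^+ e.+1).@[X j] *: (g i * g j) = F * w.
    have [->|/dvdF[w ->]] := eqVneq j i.
      by exists 0; rewrite rmorphXn /= lin_meval dotC dot_crossl expr0n scale0r mulr0.
    by exists ((lin m ^+ e.+1).@[X j] *: w); rewrite scalerAr.
  exists (\sum_j w j); rewrite mulrC [X in _ * X]em !mulr_sumr; apply: eq_bigr => j _.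
  by rewrite -hw scalerAr.
(* [F], of degree e+3, would divide the nonzero form [g i] of degree e+1. *)
move/(mdvd_lin_expr_cancel nm mF)/(mdvd_homog_le hF (hgi i)) => H.
suff /H : g i != 0 by lia.
by apply/eqP => gi0; have /eqP := gX i i; rewrite gi0 meval0 eqxx eq_sym oner_eq0.
Qed.

Lemma splits : exists L : 'I_e.+3 -> vec3 k, (forall i, nonzero3 (L i)) /\
  forall i, sing (X i) (\prod_(j <- enum 'I_e.+3) lin (L j)).
Proof.
have [s [g [ns eF sn hg ng]]] := linear_factors hF F0.
have P0 : \prod_(l <- s) lin l != 0 by apply: prod_lin_neq0.
have PX i : (\prod_(l <- s) lin l).@[X i] = 0.
  have [l [nl lX]] := linear_factor_through i; rewrite eF => /(lin_prime nl)[|/(ng l nl)//].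
  move/(mdvd_lin_prod nl) => [l' l's h]; apply/eqP/meval_prod_lin; exists l' => //.
  by have := mdvd_lin_meval lX h; rewrite lin_meval.
have es : (e.+1 < size s)%N.
  rewrite ltnNge; apply/negP => le; case/negP: P0; apply/eqP.
  exact: (no_form_le le hX (prod_lin_homog s id)).
(* With exactly e+2 linear factors the cofactor [g] would be a nonzero linear form, hence one more
   linear factor. *)
have {}es : size s = e.+3.
  apply/eqP; rewrite eqn_leq sn /= ltnNge; apply/negP => le.
  have s2 : size s = e.+2 by lia.
  move: hg; rewrite s2 subSnn => /lin_of_homog1[l el].
  case: (ng l); last by exists 1; rewrite el mulr1.
  apply: NNPP => l0; case/negP: F0; rewrite eF el.
  suff -> : lin l = 0 by rewrite mulr0.
  rewrite /lin big1 // => j _; have [->|lj] := eqVneq (l j) 0; first by rewrite scale0r.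
  by case: l0; exists j.
exists (fun i => nth [ffun=> 0] s i); split=> [i|i].
  by apply/ns/mem_nth; rewrite es.
have -> : \prod_(j <- enum 'I_e.+3) lin (nth [ffun=> 0] s j) = \prod_(l <- s) lin l.
  by rewrite big_enum /= (big_nth [ffun=> 0]) es big_mkord.
have [g1 eg] : exists c, g = c%:MP.
  exists (g@_0); apply: msize1_polyC.
  have [->|g0] := eqVneq g 0; first by rewrite msize0.
  by rewrite (dhomog_msizeE hg g0) es subnn.
have c0 : g1 != 0 by apply: contraNneq F0 => g10; rewrite eF eg g10 mpolyC0 mulr0.
have -> : \prod_(l <- s) lin l = F * (g1^-1)%:MP.
  by rewrite eF eg -mulrA -mpolyCM mulfV // mpolyC1 mulr1.
exact: sing_mulr.
Qed.

End Core.

(** * From a product of lines to a star configuration *)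

Section LinesToStar.
Variables (N e : nat) (X : 'I_N -> vec3 k).
Hypotheses (hX : no_form X e.+1).
Hypothesis nX : forall i, nonzero3 (X i).
Variable L : 'I_e.+3 -> vec3 k.
Hypothesis nL : forall i, nonzero3 (L i).
Hypothesis LX : forall i, sing (X i) (\prod_(j <- enum 'I_e.+3) lin (L j)).

(** One factor [lin (L a)] vanishes at the point; there the gradient of the product is [L a] times
    the value of the remaining factors, so one of these vanishes too. *)
Lemma two_lines_through i : exists a b, [/\ a != b, dot (L a) (X i) = 0 & dot (L b) (X i) = 0].
Proof.
have [/eqP/meval_prod_lin[a aE la] dX] := LX i.
pose rest := \prod_(j <- [seq j <- enum 'I_e.+3 | j != a]) lin (L j).
have eP : \prod_(j <- enum 'I_e.+3) lin (L j) = lin (L a) * rest.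
  by rewrite (bigD1_seq a aE (enum_uniq _)) /= /rest big_filter.
have [r ar] := nL a; have := dX r.
rewrite eP mderivM mderiv_lin mevalD !mevalM lin_meval la mul0r addr0 mevalC => /eqP.
rewrite mulf_eq0 (negbTE ar) /= => /meval_prod_lin[b].
rewrite mem_filter => /andP[ba _] lb; exists a, b; split=> //.
by rewrite eq_sym.
Qed.

Lemma point_on_exactly a b : a != b -> exists i, [/\ dot (L a) (X i) = 0, dot (L b) (X i) = 0 &
  forall c, c != a -> c != b -> dot (L c) (X i) != 0].
Proof.
move=> ab; pose r := [seq c <- enum 'I_e.+3 | (c != a) && (c != b)].
have sr : size r = e.+1.
  rewrite -sum1_size big_filter big_enum_cond sum1_card.
  have : #|~: [set a; b]| = e.+1.
    by have := cardsC [set a; b]; rewrite cards2 ab card_ord /=; lia.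
  by apply: etrans; apply: eq_card => c; rewrite !inE negb_or.
have P0 : \prod_(c <- r) lin (L c) != 0 by apply: prod_lin_neq0.
have [i Pi] : exists i, (\prod_(c <- r) lin (L c)).@[X i] != 0.
  apply: NNPP => h; case/negP: P0; apply/eqP/hX.
    by have := prod_lin_homog r L; rewrite sr.
  by move=> i; apply/eqP/negPn/negP => Pi; apply: h; exists i.
have off c : c != a -> c != b -> dot (L c) (X i) != 0.
  move=> ca cb; apply: contra Pi => /eqP h; apply/meval_prod_lin; exists c => //.
  by rewrite mem_filter ca cb mem_enum.
have [x [y [xy lx ly]]] := two_lines_through i.
have xab z : dot (L z) (X i) = 0 -> z = a \/ z = b.
  move=> lz; have [za|za] := eqVneq z a; first by left.
  have [zb|zb] := eqVneq z b; first by right.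
  by have := off z za zb; rewrite lz eqxx.
exists i; case: (xab x lx) (xab y ly) => ex [] ey; subst x y; rewrite ?eqxx // in xy *.
all: by split.
Qed.

Lemma lines_star : good_lines L /\
  (forall i, inter_pts L (X i)) /\
  (forall p, nonzero3 p -> inter_pts L p -> exists i, proportional (X i) p).
Proof.
have third a b : exists c : 'I_e.+3, c != a /\ c != b.
  have : (0 < #|~: [set a; b]|)%N.
    by have := cardsC [set a; b]; rewrite card_ord cards2; case: (a != b) => /=; lia.
  by case/card_gt0P => c; rewrite !inE negb_or => /andP[ca cb]; exists c.
(* With a third index [m], some point lies on [L a] and [L m] and on no other line; it would lie on
   [L b]. *)
have npL a b : a != b -> ~ proportional (L a) (L b).
  move=> ab [c [c0 hc]]; have [m [ma mb]] := third a b.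
  have [|i [la lm h]] := @point_on_exactly a m; first by rewrite eq_sym.
  have := h b; rewrite eq_sym ab eq_sym mb => /(_ erefl erefl) /eqP; apply.
  rewrite /dot; under eq_bigr do rewrite hc -mulrA.
  by rewrite -mulr_sumr -/(dot (L a) (X i)) la mulr0.
have onp a b p : a != b -> nonzero3 p -> dot (L a) p = 0 -> dot (L b) p = 0 ->
    exists i, proportional (X i) p /\ forall c, c != a -> c != b -> dot (L c) (X i) != 0.
  move=> ab np la lb; have [i [ia ib h]] := point_on_exactly ab.
  exists i; split=> //.
  by apply: on_two_lines (cross_neq0 (nL a) (nL b) (npL a b ab)) _ _ _ _ _ _.
split; [split=> //; split=> // a b c p ab bc ac np [la lb lc]|split].
- have [i [hi h]] := onp a b p ab np la lb.
  have /eqP : dot (L c) (X i) != 0 by apply: h; rewrite eq_sym.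
  apply.
  exact: dot_proportional (proportional_sym hi) lc.
- move=> i; have [a [b [ab la lb]]] := two_lines_through i.
  by exists a, b.
- move=> p np [a [b [ab [la lb]]]]; have [i [hi _]] := onp a b p ab np la lb.
  by exists i.
Qed.

End LinesToStar.

End Splitting.

(** * Finite sets of points *)

Section PointLists.
Variable k : fieldType.
Implicit Types (p q v l : vec3 k) (f g h : {mpoly k[3]}).

Hypothesis char0 : [pchar k] =i pred0.
Hypothesis k_inf : forall N : nat, exists s : seq k, uniq s /\ size s = N.

Variables (X : seq (vec3 k)) (hX : point_list X).

Definition list_point (i : 'I_(size X)) : vec3 k := nth [ffun=> 0] X i.

Lemma list_point_neq0 i : nonzero3 (list_point i).
Proof. by case: hX => h _; apply/h/mem_nth. Qed.

Lemma list_point_prop i j : i != j -> ~ proportional (list_point i) (list_point j).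
Proof. by case: hX => _ h ij; apply: h. Qed.

Lemma list_forall (P : vec3 k -> Prop) :
  (forall p, nonzero3 p -> in_list X p -> P p) <-> (forall i, P (list_point i)).
Proof.
split=> [h i|h p _ /(nthP [ffun=> 0])[i li <-]]; last exact: (h (Ordinal li)).
by apply: h (list_point_neq0 i) _; apply: mem_nth.
Qed.

Lemma hilb_red d :
  hilb (red_ideal (in_list X)) d = \dim (limg (evhom (@jet0 k) list_point d)).
Proof.
apply: hilb_limg => f; rewrite (red_idealP _ (valP f)) list_forall; split.
  by move=> h; apply/eqP; rewrite -memv_ker; apply/evhomP => i j; apply: h.
by move/eqP; rewrite -memv_ker => /evhomP h i; apply: (h i ord0).
Qed.

Lemma hilb_red_le d : (hilb (red_ideal (in_list X)) d <= size X)%N.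
Proof.
by rewrite hilb_red; apply: leq_trans (dimvS (subvf _)) _; rewrite dimvf /dim /= muln1.
Qed.

(* A product of lines, one through each of the other points, separates a point. *)
Lemma hilb_red_top : hilb (red_ideal (in_list X)) (size X).-1 = size X.
Proof.
rewrite hilb_red; suff -> : limg (evhom (@jet0 k) list_point (size X).-1) = fullv.
  by rewrite dimvf /dim /= muln1.
apply/vspaceP => M; rewrite memvf.
suff H i : delta_mx i ord0 \in limg (evhom (@jet0 k) list_point (size X).-1).
  rewrite [M](_ : _ = \sum_i M i ord0 *: delta_mx i ord0).
    by apply: rpred_sum => i _; apply: rpredZ.
  apply/matrixP => i j; rewrite summxE (bigD1 i) //= big1 => [|i' ii'].
    by rewrite addr0 !mxE !ord1 !eqxx mulr1.
  by rewrite !mxE [i == _]eq_sym (negbTE ii') mulr0.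
have /fin_all_exists[l hl] j : exists l, j != i ->
    dot l (list_point j) = 0 /\ dot l (list_point i) != 0.
  have [->|ji] := eqVneq j i; first by exists 0.
  have [l hl] := separating_line (list_point_neq0 j) (list_point_neq0 i) (list_point_prop ji).
  by exists l.
pose r := [seq j <- enum 'I_(size X) | j != i].
have sr : size r = (size X).-1.
  rewrite -sum1_size big_filter big_enum_cond sum1_card.
  by have := cardC1 i; rewrite card_ord.
have hf := prod_lin_homog r l; rewrite sr in hf.
pose c := (\prod_(j <- r) lin (l j)).@[list_point i].
have c0 : c != 0.
  apply/negP => /meval_prod_lin[j]; rewrite mem_filter => /andP[/hl[_ h] _] e.
  by rewrite e eqxx in h.
apply/memv_imgP; exists (c^-1 *: DHomog hf); first exact: memvf.
rewrite lfunE; apply/matrixP => a b; rewrite !mxE ord1 eqxx andbT /= mevalZ.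
have [->|ai] := eqVneq a i; first by rewrite mulVf.
suff /meval_prod_lin/eqP -> : exists2 j, j \in r & dot (l j) (list_point a) = 0 by rewrite mulr0.
exists a; first by rewrite mem_filter ai mem_enum.
by case: (hl a ai).
Qed.

Variable e : nat.
Hypothesis hred : forall d : nat, dhilb (red_ideal (in_list X)) d =
  (if (d <= e)%N then (d.+1)%:Z else 0).

Lemma hilb_red_eq d : hilb (red_ideal (in_list X)) d = 'C((minn d e).+2, 2).
Proof.
elim: d => [|d IH]; first by have := hred 0; rewrite min0n /= => -[->].
have := hred d.+1; rewrite /= IH; case: (leqP d.+1 e) => [le|gt].
  by rewrite (minn_idPl (ltnW le)) (binS2 d.+2); lia.
by rewrite (minn_idPr (_ : e <= d)%N) //; lia.
Qed.

(** The Hilbert function is bounded by [size X] and reaches it in degree [(size X).-1], while its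
    largest value is the binomial, attained in degree [e]. *)
Lemma size_points : size X = 'C(e.+2, 2).
Proof.
apply/eqP; rewrite eqn_leq; apply/andP; split.
  rewrite -{1}hilb_red_top hilb_red_eq; apply: leq_bin2l.
  by rewrite !ltnS geq_minr.
by have := hilb_red_le e; rewrite hilb_red_eq minnn.
Qed.

(** In degree [e] the Hilbert function equals the dimension of all forms, so evaluation at the
    points is injective. *)
Lemma points_no_form : no_form list_point e.
Proof.
move=> f hf fX; have := limg_ker_dim (evhom (@jet0 k) list_point e) fullv.
rewrite capfv -hilb_red hilb_red_eq minnn dim_homog -[RHS]add0n => /addIn/eqP.
rewrite dimv_eq0 => /eqP/vspaceP/(_ (DHomog hf)); rewrite memv0.
rewrite (introT (evhomP _ _ _)) => [/esym/eqP/(congr1 val)|i j] //.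
Qed.

Lemma hilb_fat_list d : (hilb (fat_ideal (in_list X)) d +
  \dim (sing_forms list_point d) = 'C(d.+2, 2))%N.
Proof. by apply: (hilb_fat char0 k_inf) => f _; apply: list_forall. Qed.

Lemma hilb_fat_low d : (d <= (e + e).+1)%N ->
  ('C(d.+2, 2) <= hilb (fat_ideal (in_list X)) d + 'C(d - e, 2))%N.
Proof.
move=> le; rewrite -(hilb_fat_list d) leq_add2l.
exact: (dim_sing_forms_le char0 k_inf size_points list_point_neq0 points_no_form le).
Qed.

Lemma hilb_fat_high d : ((e + e).+1 <= d)%N ->
  (3 * 'C(e.+2, 2) <= hilb (fat_ideal (in_list X)) d)%N.
Proof.
elim: d => // d IH; rewrite leq_eqVlt => /predU1P[<-|le].
  have := hilb_fat_list (e + e).+1.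
  rewrite (dim_sing_forms_regularity char0 size_points points_no_form).
  by have := bin2_regularity e; lia.
have := IH le; have := hilb_fat_list d; have := hilb_fat_list d.+1; rewrite binS2.
by have /andP[] := dim_sing_mono char0 k_inf d list_point_neq0; lia.
Qed.

End PointLists.

(** * The equality case and the comparison of Hilbert functions *)

Lemma star_of_points (k : fieldType) (char0 : [pchar k] =i pred0)
  (k_inf : forall n : nat, exists s : seq k, uniq s /\ size s = n) e (X : seq (vec3 k)) :
  point_list X -> size X = 'C(e.+3, 2) -> no_form (list_point (X := X)) e.+1 ->
  (0 < \dim (sing_forms (list_point (X := X)) e.+3))%N ->
  exists L' : 'I_e.+3 -> vec3 k, good_lines L' /\ same_points X (inter_pts L').
Proof.
move=> hX sX noX; rewrite lt0n dimv_eq0 -subv0 => /subvPn[F FZ]; rewrite memv0 => F0.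
have {}F0 : val F != 0 by apply: contraNneq F0 => h; apply/eqP/val_inj.
have nX := list_point_neq0 hX.
have [L [nL LX]] := splits char0 k_inf sX noX nX (valP F) F0 (elimT (sing_formsP _ _) FZ).
have [gL [XL LX']] := lines_star noX nX nL LX.
exists L; split=> //; split=> [p /(nthP [ffun=> 0])[i li <-]|p np pL].
  exact: (XL (Ordinal li)).
have [i hi] := LX' p np pL; exists (list_point i) => //; exact: mem_nth.
Qed.

(** The case t = 2: the first line joins [p] to a basis point, the second joins [p] to a point [q]
    off the first. *)
Lemma two_lines_at (k : fieldType) (X : seq (vec3 k)) :
  point_list X -> size X = 1 ->
  exists L' : 'I_2 -> vec3 k, good_lines L' /\ same_points X (inter_pts L').
Proof.
case: X => [|p [|//]] // [np _] _; have {}np := np p (mem_head _ _).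
have [i pi] := np; pose j : 'I_3 := if i == ord0 then ord_max else ord0.
have ji : (j == i) = false.
  by rewrite /j; have [->|i0] := eqVneq i ord0; rewrite // eq_sym (negbTE i0).
have [] := @cross_neq0 _ p [ffun a => (a == j)%:R] np.
- by exists j; rewrite ffunE eqxx oner_eq0.
- move=> [c [c0 /(_ i)/eqP]]; rewrite ffunE [i == j]eq_sym ji eq_sym.
  by rewrite mulf_eq0 (negbTE c0) (negbTE pi).
set l := cross _ _ => a la; have nl : nonzero3 l by exists a.
have [q lq] := exists_dot1 nl.
have lp : dot l p = 0 by rewrite dotC dot_crossl.
have nq : nonzero3 q.
  apply: NNPP => h; have /eqP := lq; rewrite /dot big1 ?(eq_sym 0) ?oner_eq0 // => b _.
  by have [->|qb] := eqVneq (q b) 0; [rewrite mulr0 | case: h; exists b].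
have nm : nonzero3 (cross p q).
  apply: cross_neq0 => // /dot_proportional/(_ lp)/eqP; by rewrite lq oner_eq0.
set m := cross p q in nm.
have mp : dot m p = 0 by rewrite dotC dot_crossl.
have mq : dot m q = 0 by rewrite dotC dot_crossr.
have lm : ~ proportional l m.
  move=> /proportional_sym[c [_ h]]; have /eqP := lq.
  rewrite /dot; under eq_bigr do rewrite h -mulrA.
  by rewrite -mulr_sumr -/(dot m q) mq mulr0 eq_sym oner_eq0.
pose L' (i : 'I_2) := if i == ord0 then l else m.
have L'p b : dot (L' b) p = 0 by rewrite /L'; case: ifP.
have two (b c : 'I_2) : b != c -> (b = ord0 /\ c = ord_max) \/ (b = ord_max /\ c = ord0).
  by case: b c => [[|[|//]] hb] [[|[|//]] hc] // _; [left|right]; split; apply: val_inj.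
exists L'; split; first split.
- by move=> b; rewrite /L'; case: ifP.
- split=> [b c /two[][-> ->]|b c d v bc cd bd]; rewrite /L' //=.
    by move/proportional_sym.
  by move: bd; case: (two _ _ bc) (two _ _ cd) => -[-> ->] [][] // _ ->; rewrite eqxx.
split=> [v|v nv [b [c [bc [hb hc]]]]].
  by rewrite inE => /eqP ->; exists ord0, ord_max; split=> //; split; apply: L'p.
exists p; first exact: mem_head.
have [lv mv] : dot l v = 0 /\ dot m v = 0.
  by case: (two _ _ bc) hb hc => -[-> ->].
exact: on_two_lines (cross_neq0 nl nm lm) np nv lp mp lv mv.
Qed.

Theorem theorem7p10 (k : fieldType)
  (k_char0 : [pchar k] =i pred0)
  (k_inf : forall n : nat, exists s : seq k, uniq s /\ size s = n)
  (t : nat) (t_ge2 : (2 <= t)%N) (L : 'I_t -> vec3 k) (hL : good_lines L) :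
  let hZt := hilb (fat_ideal (inter_pts L)) in
  (* (a) *)
  (forall d : nat,
     dhilb (fat_ideal (inter_pts L)) d =
       (if (d <= t.-1)%N then (d.+1)%:Z
        else if (d <= 2 * t - 3)%N then t%:Z else 0)) /\
  (forall X : seq (vec3 k), point_list X ->
     (forall d : nat, dhilb (red_ideal (in_list X)) d =
        (if (d <= t - 2)%N then (d.+1)%:Z else 0)) ->
     let hZ := hilb (fat_ideal (in_list X)) in
     (* (b) *)
     (forall d : nat, (hZt d <= hZ d)%N) /\
     (* (c) *)
     (hZ t = hZt t ->
        exists L' : 'I_t -> vec3 k, good_lines L' /\ same_points X (inter_pts L'))).
Proof.
case: t t_ge2 L hL => [|[|e]] // _ L hL hZt.
have low := hilb_star_low k_char0 k_inf hL.
have high := hilb_star_high k_char0 k_inf hL.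
rewrite -/hZt in low high.
have et : (2 * e.+2 - 3 = (e + e).+1)%N by lia.
split=> [[|d]|X hX hred hZ].
- by rewrite /= -/hZt; have := low 0 isT; rewrite sub0n bin0n addn0 => ->.
- rewrite /= -/hZt et; have [le|gt] := leqP d.+1 (e + e).+1.
    have := low d.+1 le; have := low d (ltnW le); rewrite (binS2 d.+2).
    (* Beyond degree e+1 the difference is (d+2) - (d-e) = e+2 = t; up to it both corrections are
       0. *)
    case: (leqP d.+1 e.+1) => de; last by rewrite subSn ?(binS2 (d - e)); lia.
    by rewrite (@bin_small (d - e)) ?(@bin_small (d.+1 - e)); lia.
  by rewrite ifF ?high; lia.
rewrite subn2 /= in hred.
have blow := hilb_fat_low k_char0 k_inf hX hred.
have bhigh := hilb_fat_high k_char0 k_inf hX hred.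
split=> [d|ht].
  have [le|/ltnW gt] := leqP d (e + e).+1; last by rewrite high //; apply: bhigh.
  by have := low d le; have := blow d le; rewrite -/hZ; lia.
have sX := size_points hX hred.
(* A single point is treated apart: the splitting argument assumes t at least 3. *)
case: e => [|e] in L hL hZt low high et hred blow bhigh ht sX *.
  by apply: two_lines_at => //; rewrite sX.
apply: star_of_points => //; first exact: points_no_form hred.
have := hilb_fat_list k_char0 k_inf hX e.+3; rewrite -/hZ ht.
have le : (e.+3 <= (e.+1 + e.+1).+1)%N by lia.
(* In degree t the star has a system of dimension binom(2, 2) = 1, so equality of Hilbert functions
   yields a nonzero singular form. *)
by have := low _ le; rewrite (_ : e.+3 - e.+1 = 2)%N ?binn; lia.
Qed.
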